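(* Let $\mathcal{H}$ be a finite dimensional real or complex inner product space, let $A:\mathcal{H}\to\mathcal{H}$ be a linear Hermitian operator, and let $\mathcal{X}$ and $\mathcal{Y}$ be subspaces of $\mathcal{H}$ with $\dim\mathcal{X}=\dim\mathcal{Y}$. Suppose that $\mathcal{X}$ is $A$-invariant and corresponds to the contiguous set of the largest eigenvalues of $A$. Then $$\left|\Lambda\left((P_{\mathcal{X}}A)|_{\mathcal{X}}\right)-\Lambda\left((P_{\mathcal{Y}}A)|_{\mathcal{Y}}\right)\right|\prec_w \mathrm{Spr}_{(\mathcal{X}+\mathcal{Y})}\,\sin^2\Theta(\mathcal{X},\mathcal{Y}).$$ Consequently, $$0\le\Lambda\left((P_{\mathcal{X}}A)|_{\mathcal{X}}\right)-\Lambda\left((P_{\mathcal{Y}}A)|_{\mathcal{Y}}\right)\prec_w\left(\Lambda\left((P_{\mathcal{X}}A)|_{\mathcal{X}}\right)-\lambda_{\min(\mathcal{X}+\mathcal{Y})}\right)\sin^2\Theta(\mathcal{X},\mathcal{Y}).$$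
   Context: For a subspace $\mathcal{Z}$, $P_{\mathcal{Z}}$ is the orthogonal projector onto $\mathcal{Z}$, and $(P_{\mathcal{Z}}A)|_{\mathcal{Z}}$ is the restriction of $P_{\mathcal{Z}}A$ to $\mathcal{Z}$, a Hermitian operator on $\mathcal{Z}$. $\Lambda(\cdot)$ is the vector of eigenvalues of a Hermitian operator, repeated according to multiplicity and arranged in decreasing (i.e. nonincreasing) order. An $A$-invariant subspace $\mathcal{X}$ corresponds to the contiguous set of the largest eigenvalues of $A$ if the eigenvalues of $A|_{\mathcal{X}}$ are the $\dim\mathcal{X}$ largest eigenvalues of $A$, counting multiplicities. Principal angles: for $\dim\mathcal{X}\le\dim\mathcal{Y}$, the vector $\Theta(\mathcal{X},\mathcal{Y})$ of $\dim\mathcal{X}$ angles from $\mathcal{X}$ to $\mathcal{Y}$ has components in $[0,\pi/2]$ arranged in decreasing order, and the components of $\cos^2\Theta(\mathcal{X},\mathcal{Y})$ are the eigenvalues of $(P_{\mathcal{X}}P_{\mathcal{Y}})|_{\mathcal{X}}$ arranged in increasing order. $\lambda_{\min(\mathcal{X}+\mathcal{Y})}$ is the smallest eigenvalue of $(P_{\mathcal{X}+\mathcal{Y}}A)|_{\mathcal{X}+\mathcal{Y}}$. The vector $\mathrm{Spr}_{(\mathcal{X}+\mathcal{Y})}=\left[\lambda_{i(\mathcal{X}+\mathcal{Y})}-\lambda_{-i(\mathcal{X}+\mathcal{Y})},\ i=1,\ldots,\dim\mathcal{X}\right]$, where $\lambda_{1(\mathcal{X}+\mathcal{Y})}\ge\cdots\ge\lambda_{\dim\mathcal{X}(\mathcal{X}+\mathcal{Y})}$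 are the $\dim\mathcal{X}$ largest, and $\lambda_{-1(\mathcal{X}+\mathcal{Y})}\le\cdots\le\lambda_{-\dim\mathcal{X}(\mathcal{X}+\mathcal{Y})}$ the $\dim\mathcal{X}$ smallest, eigenvalues of $(P_{\mathcal{X}+\mathcal{Y}}A)|_{\mathcal{X}+\mathcal{Y}}$, counting multiplicities. Functions, products and inequalities ($\le$) of vectors are component-wise; a scalar in a vector expression denotes the constant vector. For a real vector $x$, $x^\downarrow$ denotes its rearrangement in decreasing order. For real $n$-vectors, $x\prec_w y$ (weak majorization) means $\sum_{i=1}^k x_i^\downarrow\le\sum_{i=1}^k y_i^\downarrow$ for $k=1,\ldots,n$. *)

(* Defs.v *)
From HB Require Import structures.
From mathcomp Require Import all_boot all_order all_algebra.
From mathcomp Require Import complex.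
From mathcomp Require Import reals trigo.

Set Implicit Arguments.
Unset Strict Implicit.
Unset Printing Implicit Defensive.

Import Order.TTheory GRing.Theory Num.Theory.
Local Open Scope ring_scope.

(* The scalar field of the inner product space: R itself, or its complexification
   R[i]. *)
Variant scalars := RealScalars | ComplexScalars.

Definition scalar_field (R : realType) (k : scalars) : numFieldType :=
  match k with
  | RealScalars => R
  | ComplexScalars => R[i]
  end.

Definition sconj (R : realType) (k : scalars) :
    involutive_rmorphism (scalar_field R k) :=
  match k with
  | RealScalars => (idfun : R -> R)
  | ComplexScalars => (@Num.conj R[i] : R[i] -> R[i])
  end.

Definition scalar_toC (R : realType) (k : scalars) :
    {rmorphism scalar_field R k -> R[i]} :=
  match k with
  | RealScalars => real_complex R
  | ComplexScalars => (idfun : R[i] -> R[i])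
  end.

Section Spectrum.
Variables (R : realType) (k : scalars).

Definition charpoly (V : vectType (scalar_field R k)) (f : 'End(V)) :
    {poly scalar_field R k} :=
  char_poly (passmx.mxof (vbasis {:V}) (vbasis {:V}) f).

Definition spectrumC (V : vectType (scalar_field R k)) (f : 'End(V)) : seq R[i] :=
  sval (closed_field_poly_normal
    (map_poly (@scalar_toC R k) (charpoly f))).

(* Roots of the characteristic polynomial with multiplicity. For a Hermitian f
   they are all real, so that taking real parts forgets nothing; see LambdaE. *)
Definition Lambda (V : vectType (scalar_field R k)) (f : 'End(V)) : seq R :=
  sort >=%R [seq complex.Re z | z <- spectrumC f].

Lemma charpolyC (V : vectType (scalar_field R k)) (f : 'End(V)) :
  map_poly (@scalar_toC R k) (charpoly f)
    = \prod_(z <- spectrumC f) ('X - z%:P).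
Proof.
rewrite /spectrumC; case: closed_field_poly_normal => r /= e.
by rewrite {1}e lead_coef_map (monicP (char_poly_monic _)) rmorph1 scale1r.
Qed.

Lemma LambdaE (V : vectType (scalar_field R k)) (f : 'End(V)) (s : seq R) :
  sorted >=%R s ->
  map_poly (@scalar_toC R k) (charpoly f)
    = \prod_(x <- s) ('X - ((x%:C)%C)%:P) ->
  Lambda f = s.
Proof.
move=> ss; rewrite charpolyC => e.
have p : perm_eq (spectrumC f) [seq (x%:C)%C | x <- s].
  by apply: prod_XsubC_eq; rewrite e big_map.
have ge_anti : antisymmetric (>=%R : rel R) by exact: ge_anti.
apply: (sorted_eq ge_trans ge_anti) => //.
  by apply: sort_sorted => x y; apply: ge_total.
rewrite perm_sort; have := perm_map (@complex.Re R) p.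
by rewrite -map_comp map_id_in.
Qed.

Lemma size_Lambda (V : vectType (scalar_field R k)) (f : 'End(V)) :
  size (Lambda f) = \dim {:V}.
Proof.
rewrite size_sort size_map; apply: succn_inj.
by rewrite -(size_prod_XsubC _ idfun) -charpolyC size_map_poly size_char_poly.
Qed.

End Spectrum.

Section Operators.
Variables (R : realType) (k : scalars) (H : vectType (scalar_field R k)).
Variable dot : {dot H for @sconj R k}.

Definition hermitian_op (A : 'End(H)) : Prop :=
  forall u v : H, dot (A u) v = dot u (A v).

Definition orthoproj (Z : {vspace H}) : 'End(H) := daddv_pi Z (orthov dot Z).

Lemma orthoproj_mem (Z : {vspace H}) (u : H) : orthoproj Z u \in Z.
Proof. exact: memv_pi. Qed.

Lemma orthoproj_ortho (Z : {vspace H}) (u v : H) :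
  v \in Z -> dot (u - orthoproj Z u) v = 0.
Proof.
have cap0 : (Z :&: orthov dot Z = 0)%VS.
  apply/eqP; rewrite -subv0; apply/subvP => w; rewrite memv_cap memv0.
  case/andP => wZ /mem_orthovP /(_ w wZ) ww0; apply: contraT => w0.
  by have := @neq0_dnorm_gt0 _ _ _ dot w w0; rewrite ww0 ltxx.
pose t (w : H) : 'rV[scalar_field R k]_(\dim Z) := \row_i dot w (vbasis Z)`_i.
have lin : linear t by move=> a x y; apply/rowP => i; rewrite !mxE linearPl.
pose G : {linear H -> 'rV[scalar_field R k]_(\dim Z)} :=
  HB.pack t (GRing.isLinear.Build _ _ _ _ _ lin).
pose T := linfun G; have TE w : T w = t w by rewrite lfunE.
have kerT : (lker T <= orthov dot Z)%VS.
  apply/subvP => w; rewrite memv_ker TE => /eqP/rowP T0.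
  apply/mem_orthovP => z /coord_vbasis ->.
  rewrite linear_sumr big1 // => i _; rewrite linearZr /=.
  by have := T0 i; rewrite !mxE => ->; rewrite mulr0.
have full : (Z + orthov dot Z = fullv)%VS.
  apply/eqP; rewrite eqEdim subvf /= dimv_disjoint_sum //.
  rewrite -(limg_ker_dim T fullv) capfv addnC leq_add ?dimvS //.
  by rewrite (leq_trans (dimvS (subvf _))) // dimvf /dim /= mul1n.
move=> vZ; suff : u - orthoproj Z u \in orthov dot Z by move/mem_orthovP; apply.
have := daddv_pi_add cap0 (w := u); rewrite full memvf => /(_ isT) {1}<-.
by rewrite addrC addKr memv_pi.
Qed.

(* Meaningful when B maps Z into Z: vsproj Z is then applied to vectors of Z only,
   where it is the mere inclusion into the type subvs_of Z. *)
Definition restr_op (Z : {vspace H}) (B : 'End(H)) : 'End(subvs_of Z) :=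
  linfun (fun u : subvs_of Z => vsproj Z (B (vsval u))).

Definition compression (Z : {vspace H}) (A : 'End(H)) : 'End(subvs_of Z) :=
  restr_op Z (orthoproj Z \o A)%VF.

(* The angles from X to Y, for \dim X <= \dim Y. *)
Definition Theta (X Y : {vspace H}) : seq R :=
  [seq acos (Num.sqrt c)
     | c <- rev (Lambda (restr_op X (orthoproj X \o orthoproj Y)%VF))].

End Operators.

Section Vectors.
Variable R : realType.
Implicit Types x y : seq R.

Definition vsub x y : seq R := [seq p.1 - p.2 | p <- zip x y].
Definition vmul x y : seq R := [seq p.1 * p.2 | p <- zip x y].

Definition weak_maj x y : Prop :=
  size x = size y /\
  forall n : nat, (0 < n <= size x)%N ->
    \sum_(i < n) (sort >=%R x)`_i <= \sum_(i < n) (sort >=%R y)`_i.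

End Vectors.

Section Spread.
Variables (R : realType) (k : scalars) (H : vectType (scalar_field R k)).
Variable dot : {dot H for @sconj R k}.
Variables (A : 'End(H)) (X Y : {vspace H}).

Definition Spr : seq R :=
  let L := Lambda (compression dot (X + Y)%VS A) in
  vsub (take (\dim X) L) (take (\dim X) (rev L)).

(* The default value 0 is only used when X + Y is the zero space. *)
Definition lambda_min : R := last 0 (Lambda (compression dot (X + Y)%VS A)).

End Spread.

(* Main.v *)
From HB Require Import structures.
Require Import Defs.
From mathcomp Require Import all_boot all_order all_algebra.
From mathcomp Require Import fingroup perm complex.
From mathcomp Require Import reals trigo.

(* In an orthonormal basis of [X + Y] adapted to [X] and its orthogonal complement,
   [A] is [diag (a, b)], where [a] lists the eigenvalues of [A] on [X] and [b] the
   remaining ones, and the compression of [A] to [Y] has the matrix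
   [M = G a G^* + S b S^*] with [G G^* + S S^* = 1].  Take [mu = min a], so that
   [a - mu >= 0] and [mu - b >= 0].  The matrix [G (a - mu) G^*] has the same
   eigenvalues as [D^2 - D (1 - G^* G) D] with [D^2 = a - mu], and [M - mu] is obtained
   from it by subtracting [S (mu - b) S^*].  Lidskii's theorem bounds the two successive
   eigenvalue changes by the eigenvalues of [D (1 - G^* G) D] and [S (mu - b) S^*], whose
   partial sums are at most those of [(a - mu) sin^2] and [(mu - b) sin^2].  These
   add up to the spread.  Real and complex spaces are both treated over [R[i]]. *)

Set Implicit Arguments.
Unset Strict Implicit.
Unset Printing Implicit Defensive.

Import Order.TTheory GRing.Theory Num.Theory.
Local Open Scope ring_scope.
Local Open Scope sesquilinear_scope.

(** * Conjugate transposes and Hermitian forms evaluated on row vectors *)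

Section ConjugateTranspose.
Variable C : numClosedFieldType.

Lemma ctrmxM m n p (A : 'M[C]_(m, n)) (B : 'M[C]_(n, p)) :
  (A *m B)^t* = B^t* *m A^t*.
Proof. by rewrite trmx_mul map_mxM. Qed.

Lemma ctrmxD m n (A B : 'M[C]_(m, n)) : (A + B)^t* = A^t* + B^t*.
Proof. by rewrite linearD /= map_mxD. Qed.

Lemma ctrmxN m n (A : 'M[C]_(m, n)) : (- A)^t* = - A^t*.
Proof. by rewrite linearN /= map_mxN. Qed.

Lemma ctrmx1 n : (1%:M : 'M[C]_n)^t* = 1%:M.
Proof. by rewrite trmx1 map_mx1. Qed.

Lemma ctrmx_mul_unitary n (U : 'M[C]_n) : U \is unitarymx -> U^t* *m U = 1%:M.
Proof. by move=> Uu; rewrite -invmx_unitary // mulVmx ?unitarymx_unit. Qed.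

Definition quad n (A : 'M[C]_n) (v : 'rV[C]_n) : C := (v *m A *m v^t*) 0 0.

Lemma quadB n (A B : 'M[C]_n) v : quad (A - B) v = quad A v - quad B v.
Proof. by rewrite /quad mulmxBr mulmxBl !mxE. Qed.

Lemma quad_congr m n (W : 'M[C]_(m, n)) (B : 'M[C]_n) v :
  quad (W *m B *m W^t*) v = quad B (v *m W).
Proof. by rewrite /quad ctrmxM !mulmxA. Qed.

Lemma quad1E n (v : 'rV[C]_n) : quad 1%:M v = \sum_i `|v 0 i| ^+ 2.
Proof.
by rewrite /quad mulmx1 !mxE; apply: eq_bigr => i _; rewrite !mxE normCK.
Qed.

Lemma quad1_gt0 n (v : 'rV[C]_n) : v != 0 -> 0 < quad 1%:M v.
Proof.
move=> v0; rewrite quad1E lt_def sumr_ge0 ?andbT => [|i _]; last exact: exprn_ge0.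
apply: contra v0; rewrite psumr_eq0 => [/allP e|i _]; last exact: exprn_ge0.
apply/eqP/rowP => i; rewrite mxE; have := e i (mem_index_enum i).
by rewrite expf_eq0 /= normr_eq0 => /eqP.
Qed.

End ConjugateTranspose.

Lemma nth_decreasing (R : numDomainType) (s : seq R) i j :
  sorted >=%R s -> (i <= j)%N -> (j < size s)%N -> s`_j <= s`_i.
Proof.
move=> ss ij js; have := sorted_leq_nth (@ge_trans _ R) (@ge_refl _ R) 0 ss.
by apply; rewrite ?inE // (leq_ltn_trans ij).
Qed.

(** * Spectra of Hermitian matrices *)

Section Spectral.
Variable R : realType.
Local Notation C := R[i].
Implicit Types s t : seq R.

(** The diagonal comes from a function on [nat], so that [nth 0 s] can be plugged in without a size
    equation in the type. *)
Definition rdiag n (d : nat -> R) : 'M[C]_n := diag_mx (\row_i (d i)%:C%C).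

Lemma quad_rdiag n d (v : 'rV[C]_n) :
  quad (rdiag n d) v = \sum_(i < n) (d i)%:C%C * `|v 0 i| ^+ 2.
Proof.
rewrite /quad mxE; apply: eq_bigr => i _; rewrite mul_mx_diag !mxE normCK.
by rewrite mulrA [v 0 i * _]mulrC.
Qed.

Lemma ctrmx_rdiag n d : (rdiag n d)^t* = rdiag n d.
Proof.
rewrite tr_diag_mx map_diag_mx; congr diag_mx; apply/rowP => i.
by rewrite !mxE; exact: conjc_real.
Qed.

Lemma mul_rdiag n d e : rdiag n d *m rdiag n e = rdiag n (fun i => d i * e i).
Proof. by rewrite mulmx_diag; congr diag_mx; apply/rowP=> i; rewrite !mxE rmorphM. Qed.

Lemma add_rdiag n d e : rdiag n d + rdiag n e = rdiag n (fun i => d i + e i).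
Proof. by rewrite -raddfD; congr diag_mx; apply/rowP=> i; rewrite !mxE rmorphD. Qed.

Lemma eq_rdiag n d e : (forall i, (i < n)%N -> d i = e i) -> rdiag n d = rdiag n e.
Proof. by move=> de; congr diag_mx; apply/rowP=> i; rewrite !mxE de. Qed.

Lemma rdiag_cst n (a : R) : rdiag n (fun=> a) = (a%:C%C)%:M.
Proof. by rewrite -diag_const_mx; congr diag_mx; apply/rowP=> i; rewrite !mxE. Qed.

(** A relation rather than a function: it carries a unitary diagonalization with real decreasing
    entries, and so forces [A] to be Hermitian. *)
Definition spectrum_of n (A : 'M[C]_n) s : Prop :=
  [/\ size s = n, sorted >=%R s &
      exists2 U : 'M[C]_n, U \is unitarymx & A = U^t* *m rdiag n (nth 0 s) *m U].

(** The intertwining relation passes to the characteristic matrices, and [\det P] is a nonzero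
    polynomial that cancels. *)
Lemma char_poly_similar n (A B P : 'M[C]_n) :
  P \in unitmx -> P *m A = B *m P -> char_poly A = char_poly B.
Proof.
move=> Pu PA; rewrite /char_poly.
have detP : \det (map_mx polyC P) != 0.
  by rewrite det_map_mx polyC_eq0 -unitfE -unitmxE.
apply: (mulfI detP); rewrite -det_mulmx [RHS]mulrC -det_mulmx; congr (\det _).
rewrite /char_poly_mx mulmxBr mulmxBl -!map_mxM PA; congr (_ - _).
by rewrite scalar_mxC.
Qed.

Lemma char_poly_rdiag n s : size s = n ->
  char_poly (rdiag n (nth 0 s)) = \prod_(x <- s) ('X - (x%:C%C)%:P).
Proof.
move=> sn; rewrite char_poly_trig ?diag_mx_is_trig //.
rewrite (big_nth 0) sn big_mkord; apply: eq_bigr => i _.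
by rewrite !mxE eqxx.
Qed.

Lemma spectrum_of_char_poly n (A : 'M[C]_n) s :
  spectrum_of A s -> char_poly A = \prod_(x <- s) ('X - (x%:C%C)%:P).
Proof.
case=> sn _ [U Uu ->]; rewrite -(char_poly_rdiag sn).
apply: (@char_poly_similar _ _ _ U); first exact: unitarymx_unit.
by rewrite !mulmxA (unitarymxP _) // mul1mx.
Qed.

Lemma prod_XsubC_sorted s t : sorted >=%R s -> sorted >=%R t ->
  \prod_(x <- s) ('X - (x%:C%C)%:P) = \prod_(x <- t) ('X - (x%:C%C)%:P) :> {poly C} ->
  s = t.
Proof.
move=> ss st e; apply: (sorted_eq ge_trans _ ss st); first exact: ge_anti.
apply: (@perm_map_inj _ _ (real_complex R)); first exact: complexI.
by apply: prod_XsubC_eq; rewrite !big_map.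
Qed.

Lemma spectrum_of_uniq m n (A : 'M[C]_m) (B : 'M[C]_n) s t :
  spectrum_of A s -> spectrum_of B t -> char_poly A = char_poly B -> s = t.
Proof.
move=> sA tB; rewrite (spectrum_of_char_poly sA) (spectrum_of_char_poly tB).
by case: sA tB => _ ss _ [_ st _]; apply: prod_XsubC_sorted.
Qed.

Lemma perm_mx_unitary n (p : 'S_n) : (perm_mx p : 'M[C]_n) \is unitarymx.
Proof. by apply/unitarymxP; rewrite tr_perm_mx map_perm_mx -perm_mxM mulgV perm_mx1. Qed.

(** The permutation that sorts [s] is absorbed into the unitary factor. *)
Lemma spectrum_of_perm n s (U : 'M[C]_n) : size s = n -> U \is unitarymx ->
  spectrum_of (U^t* *m rdiag n (nth 0 s) *m U) (sort >=%R s).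
Proof.
move=> sn Uu; have ps : perm_eq (sort >=%R s) s by rewrite perm_sort.
split; [by rewrite size_sort | by apply: sort_sorted; exact: ge_total |].
have /tuple_permP [p ep] : perm_eq (sort >=%R s) (Tuple (introT eqP sn)) by [].
have eD : rdiag n (nth 0 (sort >=%R s)) =
    perm_mx p *m rdiag n (nth 0 s) *m (perm_mx p)^t*.
  rewrite tr_perm_mx map_perm_mx -col_permE -row_permE; apply/matrixP => i j.
  rewrite !mxE ep (nth_map i) ?size_tuple // nth_ord_enum (tnth_nth 0) /=.
  by rewrite (inj_eq perm_inj).
move: (perm_mx p) (perm_mx_unitary p) eD => P Pu ->.
exists (P *m U); first exact: mul_unitarymx Pu Uu.
have PP := ctrmx_mul_unitary Pu.
by rewrite ctrmxM -!mulmxA 2!(mulmxA (P^t*) P) PP !mul1mx.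
Qed.

Lemma spectrum_of_hermitian n (A : 'M[C]_n) : A^t* = A -> exists s, spectrum_of A s.
Proof.
move=> hA; have Ah : A \is hermsymmx.
  by apply/is_hermitianmxP; rewrite expr0 scale1r.
have /orthomx_spectralP eA := hermitian_normalmx Ah.
have /mxOverP dr := hermitian_spectral_diag_real Ah.
pose f i := complex.Re (spectral_diag A 0 i).
pose s := [seq f i | i <- enum 'I_n].
have sn : size s = n by rewrite size_map size_enum_ord.
exists (sort >=%R s); move: (spectral_unitarymx A) => Uu.
have eD : diag_mx (spectral_diag A) = rdiag n (nth 0 s).
  congr diag_mx; apply/rowP => i; rewrite mxE /s (nth_map i) ?size_enum_ord //.
  by rewrite nth_ord_enum RRe_real.
by have := spectrum_of_perm sn Uu; rewrite -eD -(invmx_unitary Uu) -eA.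
Qed.

Lemma spectrum_of_ctrmx n (A : 'M[C]_n) s : spectrum_of A s -> A^t* = A.
Proof.
by case=> _ _ [U _ ->]; rewrite !ctrmxM trmxCK ctrmx_rdiag mulmxA.
Qed.

Lemma spectrum_of_trace n (A : 'M[C]_n) s :
  spectrum_of A s -> \tr A = (\sum_(i < n) s`_i)%:C%C.
Proof.
case=> _ _ [U Uu ->]; rewrite -mulmxA mxtrace_mulC -mulmxA (unitarymxP _) // mulmx1.
by rewrite mxtrace_diag rmorph_sum; apply: eq_bigr => i _; rewrite mxE.
Qed.

Lemma spectrum_of_shift n (A : 'M[C]_n) s (a : R) :
  spectrum_of A s -> spectrum_of (A + (a%:C%C)%:M) [seq x + a | x <- s].
Proof.
case=> sn ss [U Uu ->]; split; first by rewrite size_map.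
  by apply: homo_sorted ss => x y; rewrite /= lerD2r.
exists U => //; rewrite -[X in _ + X]mulmx1 -(ctrmx_mul_unitary Uu) mulmxA.
rewrite -[_ *m U^t*]scalar_mxC -mulmxDl -mulmxDr -rdiag_cst add_rdiag.
rewrite (@eq_rdiag n _ (nth 0 [seq x + a | x <- s])) // => i lin.
by rewrite (nth_map 0) ?sn.
Qed.

(** A dimension count: the vectors supported on the first [i.+1] coordinates are subjected to only
    [i] linear conditions. *)
Lemma subspace_meet (K : fieldType) m n (W : 'M[K]_(n, m)) (i : nat) : (i < n)%N ->
  exists x : 'rV[K]_n, [/\ x != 0, forall j : 'I_n, (i < j)%N -> x 0 j = 0
    & forall l : 'I_m, (l < i)%N -> (x *m W) 0 l = 0].
Proof.
move=> lin; pose P : 'M[K]_(i.+1, n) := pid_mx i.+1.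
pose Q : 'M[K]_(m, i) := pid_mx i.
pose M := P *m W *m Q.
have /rowV0Pn[c /sub_kermxP cM c0] : kermx M != 0.
  rewrite -mxrank_eq0 mxrank_ker -lt0n subn_gt0 ltnS (leq_trans (rank_leq_col _)) //.
exists (c *m P); split.
- apply: contra c0 => /eqP cP0; apply/eqP/rowP => j; rewrite mxE.
  have lj : (j < n)%N by apply: leq_trans lin.
  have := congr1 (fun A : 'rV_n => A 0 (Ordinal lj)) cP0.
  rewrite [LHS]mxE [RHS]mxE (bigD1 j) //= [P j _]mxE /= eqxx ltn_ord mulr1.
  rewrite big1 ?addr0 // => k kj; rewrite [P k _]mxE /=.
  by rewrite (negPf (_ : (k : nat) != j)) ?mulr0.
- move=> j ij; rewrite mxE big1 // => k _; rewrite mxE /=.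
  by rewrite [_ == _](_ : _ = false) ?mulr0 //; apply: ltn_eqF; rewrite (leq_trans (ltn_ord k)).
move=> l li; have := congr1 (fun A : 'rV_i => A 0 (Ordinal li)) cM.
rewrite /M !mulmxA [LHS]mxE [RHS]mxE (bigD1 l) //=.
rewrite [Q l _]mxE /= eqxx li mulr1 big1 ?addr0 // => k kl; rewrite [Q k _]mxE /=.
by rewrite (negPf (_ : (k : nat) != l)) ?mulr0.
Qed.

(* Weyl monotonicity is the case [W = 1], Cauchy interlacing the case of equality. *)
Lemma spectrum_of_le m n (A : 'M[C]_n) (B : 'M[C]_m) (W : 'M[C]_(n, m)) s t :
  spectrum_of A s -> spectrum_of B t -> W \is unitarymx ->
  (forall v, quad A v <= quad (W *m B *m W^t*) v) ->
  forall i, (i < n)%N -> s`_i <= t`_i.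
Proof.
move=> [sn ss [U Uu eA]] [tm st [V Vu eB]] Wu AB i lin.
have nm : (n <= m)%N by rewrite -(mxrank_unitary Wu) rank_leq_col.
(* [x *m U] lies in the span of the first [i.+1] eigenvectors of [A], so its Rayleigh quotient for
   [A] is at least [s_i]. Its image under [W] is orthogonal to the first [i] eigenvectors of [B], so
   the quotient for [B] is at most [t_i]. *)
have [x [x0 xhi xlo]] := subspace_meet (U *m W *m V^t*) lin.
have := AB (x *m U); rewrite eA eB quad_congr.
have eU : quad (U^t* *m rdiag n (nth 0 s) *m U) (x *m U) = quad (rdiag n (nth 0 s)) x.
  by rewrite -[in X in quad X](trmxCK U) trmxCK -{2}(trmxCK U) quad_congr mulmxtVK.
have eV : quad (V^t* *m rdiag m (nth 0 t) *m V) (x *m U *m W) =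
          quad (rdiag m (nth 0 t)) (x *m U *m W *m V^t*).
  by rewrite -{2}(trmxCK V) quad_congr.
rewrite eU eV !quad_rdiag; set y := x *m U *m W *m V^t*.
have yx : \sum_i `|y 0 i| ^+ 2 = \sum_i `|x 0 i| ^+ 2.
  rewrite -!quad1E /quad !mulmx1 /y !ctrmxM trmxCK !mulmxA.
  by rewrite (mulmxKtV _ Vu) // !(mulmxtVK _ Wu) !(mulmxtVK _ Uu).
have x_gt0 : 0 < \sum_i `|x 0 i| ^+ 2 by rewrite -quad1E quad1_gt0.
move=> st_le; rewrite -lecR -(ler_pM2r x_gt0) -{2}yx.
apply: (le_trans _ (le_trans st_le _)); rewrite mulr_sumr; apply: ler_sum => j _.
  have [ij|ji] := ltnP i j; first by rewrite xhi // normr0 expr0n !mulr0.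
  by rewrite ler_wpM2r ?exprn_ge0 // lecR nth_decreasing // sn.
have [ji|ij] := ltnP j i.
  by have := xlo _ ji; rewrite !mulmxA -/y => ->; rewrite normr0 expr0n !mulr0.
by rewrite ler_wpM2r ?exprn_ge0 // lecR nth_decreasing // tm.
Qed.
End Spectral.

(** * Majorization *)

(** Multiplying [M] by a triangular matrix, on the right in [e1] and on the left in [e2], makes it
    block triangular with one of the two characteristic matrices on the diagonal. The identity
    follows by comparing determinants. *)
Lemma sylvester_char_poly (F : comNzRingType) m n (A : 'M[F]_(m, n)) (B : 'M[F]_(n, m)) :
  'X^n * char_poly (A *m B) = 'X^m * char_poly (B *m A).
Proof.
pose A' := map_mx polyC A; pose B' := map_mx polyC B.
pose M := block_mx ('X%:M : 'M_m) A' B' (1%:M : 'M_n).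
have e1 : M *m block_mx 1%:M 0 (- B') 1%:M =
    block_mx (char_poly_mx (A *m B)) A' 0 1%:M.
  rewrite mulmx_block !mulmx1 !mulmx0 !mul1mx !add0r mulmxN subrr.
  by rewrite /char_poly_mx map_mxM.
have e2 : block_mx 1%:M 0 (- B') 'X%:M *m M =
    block_mx 'X%:M A' 0 (char_poly_mx (B *m A)).
  rewrite mulmx_block !mulmx1 !mul0mx !mul1mx !addr0 mulNmx -scalar_mxC addNr.
  by rewrite mulNmx /char_poly_mx map_mxM addrC.
have := congr1 determinant e1; have := congr1 determinant e2.
rewrite !det_mulmx !det_lblock !det_ublock !det1 !det_scalar !mul1r !mulr1.
by move=> <- eAB; rewrite /char_poly -eAB.
Qed.

Section Majorization.
Variable R : realType.
Local Notation C := R[i].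
Implicit Types s t : seq R.

Lemma quad_urdiag_ge0 m n (U : 'M[C]_(m, n)) (d : nat -> R) v :
  (forall i, (i < m)%N -> 0 <= d i) -> 0 <= quad (U^t* *m rdiag m d *m U) v.
Proof.
move=> d0; rewrite -{2}(trmxCK U) quad_congr quad_rdiag sumr_ge0 // => i _.
by rewrite mulr_ge0 ?exprn_ge0 // (lecR 0) d0.
Qed.

Lemma unitarymx1 n : (1%:M : 'M[C]_n) \is unitarymx.
Proof. by apply/unitarymxP; rewrite ctrmx1 mulmx1. Qed.

Lemma spectrum_of_mono n (A B : 'M[C]_n) s t :
  spectrum_of A s -> spectrum_of B t -> (forall v, 0 <= quad (B - A) v) ->
  forall i, (i < n)%N -> s`_i <= t`_i.
Proof.
move=> sA tB AB; apply: (spectrum_of_le sA tB (unitarymx1 n)) => v.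
by rewrite mul1mx ctrmx1 mulmx1 -subr_ge0 -quadB.
Qed.

Lemma spectrum_of_rdiag n s : size s = n -> sorted >=%R s ->
  spectrum_of (rdiag n (nth 0 s)) s.
Proof.
by move=> sn ss; split=> //; exists 1%:M; rewrite ?unitarymx1 // ctrmx1 mulmx1 mul1mx.
Qed.

Lemma sorted_nseq0 n : sorted >=%R (nseq n (0 : R)).
Proof. by elim: n => [//|[|n] IH] //=; rewrite lexx. Qed.

Lemma spectrum_of0 n : spectrum_of (0 : 'M[C]_n) (nseq n 0).
Proof.
rewrite -[X in spectrum_of X](_ : rdiag n (nth 0 (nseq n 0)) = 0).
  by apply: spectrum_of_rdiag; rewrite ?size_nseq ?sorted_nseq0.
apply/matrixP => i j; rewrite !mxE nth_nseq if_same.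
by rewrite mul0rn.
Qed.

(** Comparison with the zero matrix; past the end the default of [nth] is 0, so the bound holds at
    every index. *)
Lemma spectrum_of_ge0 n (A : 'M[C]_n) s :
  spectrum_of A s -> (forall v, 0 <= quad A v) -> forall i, 0 <= s`_i.
Proof.
move=> sA A0 i; case: (ltnP i n) => ni; last by rewrite nth_default //; case: sA => ->.
have := spectrum_of_mono (spectrum_of0 n) sA; rewrite subr0 => /(_ A0 i ni).
by rewrite nth_nseq ni.
Qed.

Lemma quad_gram_ge0 m n (S : 'M[C]_(m, n)) v : 0 <= quad (S *m S^t*) v.
Proof.
by rewrite -[S in S *m _]mulmx1 quad_congr quad1E sumr_ge0 // => i _; rewrite exprn_ge0.
Qed.

Lemma spectrum_of_opp n (A : 'M[C]_n) s :
  spectrum_of A s -> spectrum_of (- A) (rev [seq - x | x <- s]).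
Proof.
case=> sn ss [U Uu ->]; have := @spectrum_of_perm _ n [seq - x | x <- s] U.
rewrite size_map => /(_ sn Uu).
rewrite (_ : rdiag n _ = - rdiag n (nth 0 s)).
  rewrite mulmxN mulNmx; congr spectrum_of; apply: (sorted_eq ge_trans ge_anti).
  - by apply: sort_sorted; exact: ge_total.
  - rewrite rev_sorted; apply: homo_sorted ss => x y /=.
    by rewrite lerN2.
  - by rewrite perm_sort perm_sym perm_rev.
rewrite -[RHS]raddfN; congr diag_mx; apply/rowP => i.
by rewrite !mxE (nth_map 0) ?sn // rmorphN.
Qed.

Lemma ctrmx_congr m n (W : 'M[C]_(m, n)) (A : 'M[C]_n) :
  A^t* = A -> (W *m A *m W^t*)^t* = W *m A *m W^t*.
Proof. by move=> hA; rewrite !ctrmxM trmxCK hA mulmxA. Qed.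

(** The trace is the sum of the eigenvalues of the compression, and interlacing bounds these one by
    one. *)
Lemma ky_fan k n (A : 'M[C]_n) s (W : 'M[C]_(k, n)) :
  spectrum_of A s -> W \is unitarymx ->
  \tr (W *m A *m W^t*) <= (\sum_(i < k) s`_i)%:C%C.
Proof.
move=> sA Wu.
have [b bB] := spectrum_of_hermitian (ctrmx_congr W (spectrum_of_ctrmx sA)).
rewrite (spectrum_of_trace bB) lecR; apply: ler_sum => i _.
exact: (spectrum_of_le bB sA Wu).
Qed.

Lemma rowsub_widen_unitary k n (kn : (k <= n)%N) (U : 'M[C]_n) :
  U \is unitarymx -> rowsub (widen_ord kn) U \is unitarymx.
Proof.
move=> Uu; apply/unitarymxP.
rewrite trmx_mxsub map_mxsub -mxsub_mul (unitarymxP Uu).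
by apply/matrixP => i j; rewrite !mxE.
Qed.

Lemma ky_fan_attained k n (A : 'M[C]_n) s : spectrum_of A s -> (k <= n)%N ->
  exists2 W : 'M[C]_(k, n), W \is unitarymx &
    \tr (W *m A *m W^t*) = (\sum_(i < k) s`_i)%:C%C.
Proof.
case=> sn ss [U Uu eA] kn; exists (rowsub (widen_ord kn) U).
  exact: rowsub_widen_unitary.
rewrite mul_rowsub_mx trmx_mxsub map_mxsub -mxsub_mul eA !mulmxA (unitarymxP Uu) mul1mx.
rewrite (mulmxtVK _ Uu) /mxtrace rmorph_sum; apply: eq_bigr => i _.
by rewrite !mxE eqxx.
Qed.

Lemma sorted_cat_nseq0 n s : sorted >=%R s -> (forall i, 0 <= s`_i) ->
  sorted >=%R (s ++ nseq n 0).
Proof.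
move=> ss s0; rewrite (sorted_pairwise ge_trans) pairwise_cat.
rewrite -!(sorted_pairwise ge_trans) ss sorted_nseq0 !andbT.
apply/allrelP => x y /(nthP 0)[i _ <-]; rewrite mem_nseq => /andP[_ /eqP ->].
exact: s0.
Qed.

(** By Sylvester's identity the spectra agree once padded with zeros; nonnegativity keeps the padded
    lists sorted. The lengths may differ, so equality is stated through [nth], whose default 0 does
    the padding. *)
Lemma spectrum_of_swap_nth m n (A : 'M[C]_(m, n)) (B : 'M[C]_(n, m)) s t :
  spectrum_of (A *m B) s -> spectrum_of (B *m A) t ->
  (forall i, 0 <= s`_i) -> (forall i, 0 <= t`_i) -> forall i, s`_i = t`_i.
Proof.
move=> sA tB s0 t0 i.
have prodX p : \prod_(x <- nseq p 0) ('X - ((x : R)%:C%C)%:P) = 'X^p :> {poly C}.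
  elim: p => [|p IH]; first by rewrite big_nil expr0.
  by rewrite big_cons IH subr0 exprS.
have := sylvester_char_poly A B.
rewrite (spectrum_of_char_poly sA) (spectrum_of_char_poly tB) -!prodX.
rewrite mulrC [RHS]mulrC -!big_cat /=.
case: sA tB => _ ss _ [_ st _] /(prod_XsubC_sorted _ _) e.
have {e}/(congr1 (fun u => u`_i)) := e (sorted_cat_nseq0 n ss s0) (sorted_cat_nseq0 m st t0).
suff nthE p (u : seq R) : (u ++ nseq p 0)`_i = u`_i by rewrite !nthE.
by rewrite nth_cat nth_nseq if_same; case: ltnP => // /(nth_default 0).
Qed.

Lemma spectrum_of_gram_nth m n (S : 'M[C]_(m, n)) s t :
  spectrum_of (S *m S^t*) s -> spectrum_of (S^t* *m S) t -> forall i, s`_i = t`_i.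
Proof.
move=> sS tS; apply: (spectrum_of_swap_nth sS tS).
  by apply: (spectrum_of_ge0 sS) => v; exact: quad_gram_ge0.
by apply: (spectrum_of_ge0 tS) => v; rewrite -{2}(trmxCK S) quad_gram_ge0.
Qed.

(* The Li-Mathias argument: with [t] the [#|K|]-th eigenvalue of [A - B], passing
   from [B] to [B' = B + (A - B - t)_+] raises every eigenvalue, with total increase
   the trace of the positive part, while [A <= B' + t]. *)
Lemma lidskii n (A B : 'M[C]_n) a b e (K : {set 'I_n}) :
  spectrum_of A a -> spectrum_of B b -> spectrum_of (A - B) e ->
  \sum_(i in K) (a`_i - b`_i) <= \sum_(i < #|K|) e`_i.
Proof.
move=> aA bB eAB; have [/cards0_eq ->|k_gt0] := posnP #|K|.
  by rewrite big_set0 cards0 big_ord0.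
have Kn : (#|K| <= n)%N by rewrite -[X in (_ <= X)%N]card_ord max_card.
have [en es [U Uu eE]] := eAB.
pose t := e`_(#|K|.-1); pose p i := Num.max (e`_i - t) 0.
pose F := U^t* *m rdiag n p *m U.
have p0 i : (i < n)%N -> 0 <= p i by rewrite /p le_max lexx orbT.
have hF : F^t* = F by rewrite /F -{2}(trmxCK U) ctrmx_congr ?trmxCK // ctrmx_rdiag.
have [b' bB'] : exists b', spectrum_of (B + F) b'.
  by apply: spectrum_of_hermitian; rewrite ctrmxD hF (spectrum_of_ctrmx bB).
have bb' : forall i, (i < n)%N -> b`_i <= b'`_i.
  by apply: (spectrum_of_mono bB bB') => v; rewrite addrAC subrr add0r quad_urdiag_ge0.
have ab' : forall i, (i < n)%N -> a`_i <= b'`_i + t.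
  move=> i lin; have szb' : size b' = n by case: bB'.
  rewrite -(@nth_map _ 0 _ 0 (fun x => x + t)) ?szb' //.
  apply: (spectrum_of_mono aA (spectrum_of_shift t bB')) => // v.
  have -> : B + F + (t%:C%C)%:M - A = U^t* *m rdiag n (fun i => p i + (t - e`_i)) *m U.
    rewrite -add_rdiag mulmxDr mulmxDl -/F; rewrite addrAC [B + F]addrC -!addrA; congr (F + _).
    have -> : rdiag n (fun i => t - e`_i) = (t%:C%C)%:M - rdiag n (nth 0 e).
      rewrite -rdiag_cst -raddfB; congr diag_mx.
      by apply/rowP => j; rewrite !mxE rmorphB.
    rewrite mulmxBr mulmxBl -eE scalar_mxC -mulmxA ctrmx_mul_unitary // mulmx1.
    by rewrite opprB [RHS]addrC addrA.
  apply: quad_urdiag_ge0 => j _; rewrite /p -[t - _]opprB subr_ge0.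
  by rewrite le_max lexx.
have trF : \sum_(i < n) (b'`_i - b`_i) = \sum_(i < n) p i.
  apply: (@complexI R).
  have -> : (\sum_(i < n) (b'`_i - b`_i))%:C%C = \tr (B + F) - \tr B.
    by rewrite (spectrum_of_trace bB') (spectrum_of_trace bB) sumrB rmorphB.
  rewrite mxtraceD addrAC subrr add0r /F -mulmxA mxtrace_mulC.
  rewrite (mulmxtVK _ Uu) mxtrace_diag rmorph_sum.
  by apply: eq_bigr => i _; rewrite mxE.
(* As [t] is the entry of index [#|K|.-1], the entries before index [#|K|] are at least [t] and the
   later ones at most [t], so the positive part keeps exactly the first [#|K|] differences. *)
have trP : \sum_(i < n) p i = \sum_(i < #|K|) (e`_i - t).
  rewrite (big_ord_widen n (fun i => e`_i - t) Kn) [RHS]big_mkcond; apply: eq_bigr => i _.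
  rewrite /p; case: ltnP => ik.
    by apply: max_l; rewrite subr_ge0 nth_decreasing ?en // -ltnS prednK.
  apply: max_r; rewrite subr_le0 nth_decreasing ?en //.
  by rewrite (leq_trans (leq_pred _)).
apply: (@le_trans _ _ (\sum_(i in K) (b'`_i - b`_i + t))).
  by apply: ler_sum => i _; rewrite addrAC lerB // ab'.
rewrite big_split /= sumr_const -[leRHS](subrK (t *+ #|K|)) lerD2r.
(* Every [b' - b] is nonnegative, so the sum over [K] is at most the full sum, which is a trace. *)
apply: (@le_trans _ _ (\sum_(i < n) (b'`_i - b`_i))).
  rewrite [leRHS](bigID (mem K)) /= lerDl sumr_ge0 // => i _.
  by rewrite subr_ge0 bb'.
by rewrite trF trP sumrB sumr_const card_ord.
Qed.

(** Summation by parts, in the form of a stronger induction claim: the weighted sum is at least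
    [d r] times the plain sum. *)
Lemma abel_ge0 (r : nat) (d h : nat -> R) :
  (forall i, d i.+1 <= d i) -> (forall i, 0 <= d i) ->
  (forall l, (l <= r)%N -> 0 <= \sum_(j < l) h j) ->
  0 <= \sum_(j < r) d j * h j.
Proof.
move=> dd d0 h0; suff : d r * \sum_(j < r) h j <= \sum_(j < r) d j * h j.
  by apply: le_trans; rewrite mulr_ge0 ?h0.
elim: r h0 => [|r IH] h0; first by rewrite !big_ord0 mulr0.
apply: (@le_trans _ _ (d r * \sum_(j < r.+1) h j)); first by rewrite ler_wpM2r ?h0.
rewrite !big_ord_recr /= mulrDr lerD2r IH // => l lr; apply: h0; exact: leqW.
Qed.

(** For a [W] attaining the Ky Fan maximum, the left side is the sum of [d j * g j], where [g j] is
    the squared norm of column [j] of [W *m S]. The partial sums of [g] are bounded by those of [t],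
    and summation by parts inserts the weights. *)
Lemma prod_majorization n r k (S : 'M[C]_(n, r)) (d : nat -> R) t e :
  (forall i, d i.+1 <= d i) -> (forall i, 0 <= d i) -> (forall i, (r <= i)%N -> d i = 0) ->
  spectrum_of (S *m S^t*) t -> spectrum_of (S *m rdiag r d *m S^t*) e -> (k <= n)%N ->
  \sum_(i < k) e`_i <= \sum_(i < k) d i * t`_i.
Proof.
move=> dd d0 dr tS eS kn; have [W Wu eW] := ky_fan_attained eS kn.
have trA m (T : 'M[C]_(k, m)) : \tr (T *m T^t*) = \sum_i \sum_j `|T i j| ^+ 2.
  apply: eq_bigr => i _; rewrite !mxE; apply: eq_bigr => j _.
  by rewrite !mxE normCK.
pose g (j : 'I_r) : R := complex.Re (\sum_i `|(W *m S) i j| ^+ 2).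
have gE j : (g j)%:C%C = \sum_i `|(W *m S) i j| ^+ 2.
  by rewrite /g RRe_real // realE sumr_ge0 // => i _; rewrite exprn_ge0.
have g0 j : 0 <= g j.
  by rewrite -(lecR 0) gE sumr_ge0 // => i _; rewrite exprn_ge0.
pose gn := nth 0 [seq g j | j <- enum 'I_r].
have gnE (j : 'I_r) : gn j = g j.
  by rewrite /gn (nth_map j) ?size_enum_ord // nth_ord_enum.
have sum_e : \sum_(i < k) e`_i = \sum_(j < r) d j * g j.
  apply: (@complexI R); rewrite -eW !mulmxA -[_ *m S^t* *m _]mulmxA -ctrmxM.
  rewrite rmorph_sum /mxtrace.
  under [RHS]eq_bigr => j _ do rewrite rmorphM /= gE mulr_sumr.
  rewrite exchange_big; apply: eq_bigr => i _.
  rewrite mxE; apply: eq_bigr => j _; rewrite mul_mx_diag !mxE normCK.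
  by rewrite [X in X * _]mulrC mulrA.
have sum_g_all : \sum_(j < r) g j <= \sum_(i < k) t`_i.
  rewrite -lecR; apply: le_trans (ky_fan tS Wu); rewrite !mulmxA -mulmxA -ctrmxM trA.
  by rewrite exchange_big rmorph_sum; under eq_bigr => j _ do rewrite -gE.
(* [T] keeps the first [l] columns of [S]. The trace of [T *m T^t*] is that of a compression of
   [S^t* *m S], hence at most the sum of its [l] largest eigenvalues. It is also at least the trace
   of the compression of [T *m T^t*] by [W], which is the sum of the first [l] values of [g]. *)
have sum_g l : (l <= r)%N -> \sum_(j < l) gn j <= \sum_(j < l) t`_j.
  move=> lr; pose J : 'M[C]_(l, r) := rowsub (widen_ord lr) 1%:M.
  have Ju : J \is unitarymx by apply: rowsub_widen_unitary; exact: unitarymx1.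
  pose T := S *m J^t*.
  have TE i j : (W *m T) i j = (W *m S) i (widen_ord lr j).
    rewrite /T mulmxA /J trmx_mxsub map_mxsub ctrmx1 -[W *m S in LHS]mulmx1.
    by rewrite mulmx_colsub mulmx1 mxE mulmx1.
  have [u uS] : exists u, spectrum_of (S^t* *m S) u.
    by apply: spectrum_of_hermitian; rewrite ctrmxM trmxCK.
  have [m mT] : exists m, spectrum_of (T *m T^t*) m.
    by apply: spectrum_of_hermitian; rewrite ctrmxM trmxCK.
  have m0 := spectrum_of_ge0 mT (fun v => quad_gram_ge0 T v).
  have -> : \sum_(j < l) t`_j = \sum_(j < l) u`_j.
    by apply: eq_bigr => j _; rewrite (spectrum_of_gram_nth tS uS).
  rewrite -lecR; apply: le_trans (ky_fan uS Ju).
  have -> : \tr (J *m (S^t* *m S) *m J^t*) = (\sum_(i < n) m`_i)%:C%C.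
    rewrite -(spectrum_of_trace mT) [RHS]mxtrace_mulC /T ctrmxM trmxCK.
    by rewrite !mulmxA.
  apply: (@le_trans _ _ (\sum_(i < k) m`_i)%:C%C); last first.
    rewrite lecR (big_ord_widen n (fun i => m`_i) kn) [leRHS](bigID (fun i : 'I_n => (i < k)%N)) /=.
    by rewrite lerDl sumr_ge0.
  apply: le_trans (ky_fan mT Wu).
  rewrite (mulmxA W T (T^t*)) -(mulmxA (W *m T)) -ctrmxM trA exchange_big.
  rewrite rmorph_sum; apply: ler_sum => j _.
  rewrite (gnE (widen_ord lr j)) /= gE.
  by under [leRHS]eq_bigr => i _ do rewrite TE.
(* Cutting [t] off after [k] entries turns both sides into sums of length [r] with weights [d]. *)
pose tk j := if (j < k)%N then t`_j else 0.
have -> : \sum_(i < k) d i * t`_i = \sum_(j < r) d j * tk j.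
  transitivity (\sum_(j < maxn k r) d j * tk j).
    rewrite (big_ord_widen _ (fun j => d j * t`_j) (leq_maxl k r)) big_mkcond.
    by apply: eq_bigr => j _; rewrite /tk; case: ifP => // _; rewrite mulr0.
  rewrite [RHS](big_ord_widen _ (fun j => d j * tk j) (leq_maxr k r)) [RHS]big_mkcond.
  by apply: eq_bigr => j _; case: ltnP => // /dr ->; rewrite mul0r.
rewrite sum_e -subr_ge0.
have -> : \sum_(j < r) d j * tk j - \sum_(j < r) d j * g j =
    \sum_(j < r) d j * (tk j - gn j).
  by rewrite -sumrB; apply: eq_bigr => j _; rewrite gnE mulrBr.
apply: (@abel_ge0 r d (fun j => tk j - gn j)) => // l lr; rewrite sumrB subr_ge0.
(* Up to [k] the bound [sum_g] applies; beyond [k] the sum of [tk] is constant and [sum_g_all] takes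
   over. *)
have [lk|kl] := leqP l k.
  apply: le_trans (sum_g l lr) _; rewrite le_eqVlt; apply/orP; left; apply/eqP.
  by apply: eq_bigr => j _; rewrite /tk (leq_trans (ltn_ord j)).
have -> : \sum_(j < l) tk j = \sum_(j < k) t`_j.
  by rewrite (big_ord_widen l (fun j => t`_j) (ltnW kl)) [RHS]big_mkcond.
apply: le_trans sum_g_all; rewrite (big_ord_widen r gn lr).
rewrite [leRHS](bigID (fun j : 'I_r => (j < l)%N)) /=.
under eq_bigr => j _ do rewrite gnE.
by rewrite lerDl sumr_ge0.
Qed.

End Majorization.

(** * The majorization bound for a block-diagonal operator *)

Section Core.
Variable R : realType.
Local Notation C := R[i].
Implicit Types s t : seq R.

(** The default 0 past the end preserves monotonicity because the entries are nonnegative. *)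
Lemma nth_step s : sorted >=%R s -> (forall i, 0 <= s`_i) -> forall i, s`_i.+1 <= s`_i.
Proof.
move=> ss s0 i; have [si|si] := ltnP i.+1 (size s); first exact: nth_decreasing.
by rewrite [leLHS]nth_default.
Qed.

Lemma spectrum_of_gram m n (S : 'M[C]_(m, n)) : exists s, spectrum_of (S^t* *m S) s.
Proof. by apply: spectrum_of_hermitian; rewrite ctrmxM trmxCK. Qed.

Lemma spectrum_of_size n (A : 'M[C]_n) s : spectrum_of A s -> size s = n.
Proof. by case. Qed.

Lemma spectrum_of_gram_swap n (S : 'M[C]_n) s :
  spectrum_of (S^t* *m S) s -> spectrum_of (S *m S^t*) s.
Proof.
move=> sS; have [t tS] : exists t, spectrum_of (S *m S^t*) t.
  by apply: spectrum_of_hermitian; rewrite ctrmxM trmxCK.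
suff -> : s = t by [].
apply: (@eq_from_nth _ 0); rewrite (spectrum_of_size sS) ?(spectrum_of_size tS) // => i _.
by rewrite (spectrum_of_gram_nth tS sS).
Qed.

Lemma spectrum_of_one_sub n (A : 'M[C]_n) s :
  spectrum_of A s -> spectrum_of (1%:M - A) [seq 1 - x | x <- rev s].
Proof.
move=> /spectrum_of_opp /(spectrum_of_shift 1); rewrite addrC -map_rev -map_comp.
by congr spectrum_of; apply: eq_map => x /=; rewrite addrC.
Qed.

(* Shifted by [mu = min a], [M] becomes the difference of two positive semidefinite
   matrices, which are compared with [diag a - mu] one after the other. *)
Lemma block_majorization n r (a b c lam : seq R) (G : 'M[C]_n) (S : 'M[C]_(n, r))
    (K : {set 'I_n}) :
  size a = n -> sorted >=%R a -> size b = r -> sorted <=%R b ->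
  (forall x y, x \in b -> y \in a -> x <= y) ->
  G *m G^t* + S *m S^t* = 1%:M ->
  spectrum_of (G *m rdiag n (nth 0 a) *m G^t* + S *m rdiag r (nth 0 b) *m S^t*) lam ->
  spectrum_of (G^t* *m G) c ->
  \sum_(i in K) (a`_i - lam`_i) <=
  \sum_(i < #|K|) (a`_i - (b ++ rev a)`_i) * (1 - (rev c)`_i).
Proof.
move=> an sa br sb ba GS specM cG.
set M := _ + _ in specM; pose mu := a`_n.-1.
have [n0|n_gt0] := posnP n.
  have -> : K = set0 by apply/setP => -[i hi]; exfalso; move: hi; rewrite n0.
  by rewrite big_set0 cards0 big_ord0.
have {}ba x : x \in b -> x <= mu.
  by move=> xb; apply: ba => //; rewrite mem_nth // an ltn_predL.
pose s := [seq 1 - x | x <- rev c].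
have cn := spectrum_of_size cG.
have sn : size s = n by rewrite size_map size_rev.
have specGG : spectrum_of (1%:M - G^t* *m G) s := spectrum_of_one_sub cG.
have specSS : spectrum_of (S *m S^t*) s.
  have <- : 1%:M - G *m G^t* = S *m S^t* by rewrite -GS addrAC subrr add0r.
  exact: spectrum_of_one_sub (spectrum_of_gram_swap cG).
have s0 : forall i, 0 <= s`_i.
  by apply: (spectrum_of_ge0 specSS) => v; exact: quad_gram_ge0.
have ss : sorted >=%R s by case: specSS.
have Kn : (#|K| <= n)%N by rewrite -[X in (_ <= X)%N]card_ord max_card.
(* Beyond [r = dim (X + Y) - dim X] the spread may be negative, but the sine is zero. *)
have s_r i : (r <= i)%N -> s`_i = 0.
  have [u uS] := spectrum_of_gram S.
  by move=> ri; rewrite (spectrum_of_gram_nth specSS uS) nth_default // (spectrum_of_size uS).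
pose a' := [seq x - mu | x <- a]; pose b' := [seq mu - x | x <- b].
have a'n : size a' = n by rewrite size_map.
have sa' : sorted >=%R a' by apply: homo_sorted sa => x y /=; rewrite lerD2r.
have sb' : sorted >=%R b' by apply: homo_sorted sb => x y /= xy; rewrite lerD2l lerN2.
have a'E i : (i < n)%N -> a'`_i = a`_i - mu by move=> lin; rewrite (nth_map 0) ?an.
have a'0 i : 0 <= a'`_i.
  have [lin|ni] := ltnP i n; last by rewrite nth_default ?a'n.
  by rewrite a'E // subr_ge0 nth_decreasing // ?an ?ltn_predL // -ltnS prednK.
have b'0 i : 0 <= b'`_i.
  have [lir|ri] := ltnP i r; last by rewrite nth_default // size_map br.
  by rewrite (nth_map 0) ?br // subr_ge0 ba // mem_nth ?br.
pose D : 'M[C]_n := rdiag n (fun i => Num.sqrt a'`_i).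
have DD : D *m D = rdiag n (nth 0 a').
  by rewrite mul_rdiag; apply: eq_rdiag => i _; rewrite -expr2 sqr_sqrtr.
have D_h : D^t* = D by rewrite ctrmx_rdiag.
have spec_a' : spectrum_of (rdiag n (nth 0 a')) a' by apply: spectrum_of_rdiag.
pose M1 := (G *m D) *m (G *m D)^t*.
have M1E : M1 = G *m rdiag n (nth 0 a') *m G^t*.
  by rewrite /M1 ctrmxM D_h -DD !mulmxA.
have [m mDGGD] := spectrum_of_gram (G *m D).
have mM1 : spectrum_of M1 m := spectrum_of_gram_swap mDGGD.
(* [M1] has the spectrum of [(G *m D)^t* *m (G *m D)], and it is the latter that differs from
   [D *m D] by a matrix involving only [1 - G^* G]. *)
have E1 : rdiag n (nth 0 a') - (G *m D)^t* *m (G *m D) = D *m (1%:M - G^t* *m G) *m D.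
  by rewrite ctrmxM D_h mulmxBr mulmxBl mulmx1 DD !mulmxA.
have [e1 e1E] : exists e, spectrum_of (D *m (1%:M - G^t* *m G) *m D) e.
  apply: spectrum_of_hermitian.
  by have := ctrmx_congr D (spectrum_of_ctrmx specGG); rewrite D_h.
(* The relation [GS] splits the scalar shift between the two blocks: it cancels against [a] in the
   first and leaves [b'] in the second. *)
have E2 : M1 - (M + ((- mu)%:C%C)%:M) = S *m rdiag r (nth 0 b') *m S^t*.
  set nu := ((- mu)%:C%C)%:M.
  have muE : nu = G *m ((- mu)%:C%C)%:M *m G^t* + S *m ((- mu)%:C%C)%:M *m S^t*.
    by rewrite !scalar_mxC -!mulmxA -mulmxDr GS mulmx1.
  have bb : rdiag r (nth 0 b') + (rdiag r (nth 0 b) + ((- mu)%:C%C)%:M) = 0.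
    rewrite -rdiag_cst !add_rdiag; transitivity (rdiag r (fun=> 0 : R)).
      apply: eq_rdiag => i lir.
      by rewrite (nth_map 0) ?br // addrA subrK subrr.
    by rewrite rdiag_cst raddf0.
  have aa : rdiag n (nth 0 a') = rdiag n (nth 0 a) + ((- mu)%:C%C)%:M.
    by rewrite -rdiag_cst add_rdiag; apply: eq_rdiag => i lin; rewrite a'E.
  apply/eqP; rewrite subr_eq muE /M M1E aa [in X in _ == X](addrACA (G *m _ *m _)).
  rewrite -!mulmxDl -!mulmxDr addrCA -mulmxDl -mulmxDr bb.
  by rewrite mulmx0 mul0mx addr0.
have [e2 e2E] : exists e, spectrum_of (S *m rdiag r (nth 0 b') *m S^t*) e.
  by apply: spectrum_of_hermitian; rewrite ctrmx_congr // ctrmx_rdiag.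
have L1 : \sum_(i in K) (a'`_i - m`_i) <= \sum_(i < #|K|) e1`_i.
  by apply: (lidskii K spec_a' mDGGD); rewrite E1.
have L2 : \sum_(i in K) (m`_i - [seq x - mu | x <- lam]`_i) <= \sum_(i < #|K|) e2`_i.
  by apply: (lidskii K mM1 (spectrum_of_shift (- mu) specM)); rewrite E2.
have P1 : \sum_(i < #|K|) e1`_i <= \sum_(i < #|K|) s`_i * a'`_i.
  have [_ _ [Z Zu eZ]] := specGG.
  have ZZ := ctrmx_mul_unitary Zu.
  have adjDZ : (D *m Z^t*)^t* = Z *m D by rewrite ctrmxM trmxCK D_h.
  (* Diagonalizing [1 - G^* G] by [Z] gives the form required by [prod_majorization]: here [s]
     provides the weights and [a'] is the spectrum of the Gram matrix. *)
  have aDZ : spectrum_of ((D *m Z^t*) *m (D *m Z^t*)^t*) a'.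
    by rewrite adjDZ -mulmxA (mulmxA (Z^t*) Z) ZZ mul1mx DD.
  have eDZ : spectrum_of ((D *m Z^t*) *m rdiag n (nth 0 s) *m (D *m Z^t*)^t*) e1.
    move: e1E; rewrite eZ adjDZ !mulmxA; exact.
  apply: prod_majorization (nth_step ss s0) s0 _ aDZ eDZ Kn => i ni.
  by rewrite nth_default ?sn.
have P2 : \sum_(i < #|K|) e2`_i <= \sum_(i < #|K|) b'`_i * s`_i.
  apply: prod_majorization (nth_step sb' b'0) b'0 _ specSS e2E Kn => i ri.
  by rewrite nth_default // size_map br.
have -> : \sum_(i in K) (a`_i - lam`_i) =
    \sum_(i in K) (a'`_i - m`_i) + \sum_(i in K) (m`_i - [seq x - mu | x <- lam]`_i).
  rewrite -big_split /=; apply: eq_bigr => i _.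
  rewrite a'E // (nth_map 0) ?(spectrum_of_size specM) // addrA subrK.
  by rewrite opprB addrA subrK.
apply: (le_trans (lerD (le_trans L1 P1) (le_trans L2 P2))).
(* The two weights [a' = a - mu] and [b' = mu - b] add up to [a - b], in which [mu] has
   disappeared. *)
rewrite -big_split /= le_eqVlt; apply/orP; left; apply/eqP.
apply: eq_bigr => i _; have lin : (i < n)%N by exact: leq_trans (ltn_ord i) Kn.
have -> : 1 - (rev c)`_i = s`_i by rewrite [RHS](nth_map 0) ?size_rev ?cn.
rewrite mulrC -mulrDl a'E // nth_cat br; case: ltnP => ir.
  by rewrite (nth_map 0) ?br // addrA subrK.
by rewrite s_r // !mulr0.
Qed.
End Core.

(** * Block diagonalization along an invariant subspace *)

(** The left kernel of [X^t*] has rank [r]; a basis of it is orthonormalized by the Schmidt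
    process. *)
Lemma unitary_complement (C : numClosedFieldType) n r (X : 'M[C]_(n, n + r)) :
  X \is unitarymx -> exists2 Z : 'M[C]_(r, n + r), Z \is unitarymx & X *m Z^t* = 0.
Proof.
move=> Xu; have Xr : \rank (kermx (X^t*)) = r.
  by rewrite mxrank_ker mxrank_map mxrank_tr mxrank_unitary // addKn.
have [V Vr VX] : exists2 V : 'M[C]_(r, n + r), \rank V = r & V *m X^t* = 0.
  move: (row_base _) (eq_row_base (kermx (X^t*))); rewrite Xr => V eV.
  by exists V; [rewrite eV | apply/sub_kermxP; rewrite eV].
have rnr : (r <= n + r)%N by rewrite leq_addl.
exists (schmidt V); first exact: schmidt_unitarymx.
have Vf : row_free V by rewrite /row_free Vr.
have /submxP[P eP] : (schmidt V <= V)%MS by rewrite (eqmx_schmidt_free Vf).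
have : (schmidt V *m X^t*) = 0 by rewrite eP -mulmxA VX mulmx0.
by move/(congr1 (fun B => B^t*)); rewrite ctrmxM trmxCK trmx0 map_mx0.
Qed.

Section Reduction.
Variable R : realType.
Local Notation C := R[i].
Implicit Types s t : seq R.

Lemma spectrum_of_conj n (A U : 'M[C]_n) s :
  spectrum_of A s -> U \is unitarymx -> spectrum_of (U *m A *m U^t*) s.
Proof.
move=> [sn ss [V Vu ->]] Uu; split=> //; exists (V *m U^t*).
  have U'u : U^t* \is unitarymx by rewrite trmxC_unitary.
  exact: mul_unitarymx Vu U'u.
by rewrite ctrmxM trmxCK !mulmxA.
Qed.

Lemma rdiag_cat n r s t : size s = n ->
  rdiag (n + r) (nth 0 (s ++ t)) = block_mx (rdiag n (nth 0 s)) 0 0 (rdiag r (nth 0 t)).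
Proof.
move=> sn; rewrite -diag_mx_row; congr diag_mx; apply/rowP => i.
rewrite !mxE nth_cat sn; case: splitP => j ->; rewrite mxE //.
by rewrite addKn.
Qed.

(** Invariance makes [A] block diagonal along [X] and its complement; diagonalizing both blocks
    gives the setting of [block_majorization]. *)
Lemma invariant_majorization n r (A : 'M[C]_(n + r)) (X Y : 'M[C]_(n, n + r))
    (a lam L c : seq R) (K : {set 'I_n}) :
  X \is unitarymx -> Y \is unitarymx ->
  X *m A = X *m A *m X^t* *m X ->
  spectrum_of (X *m A *m X^t*) a -> spectrum_of A L -> take n L = a ->
  spectrum_of (Y *m A *m Y^t*) lam -> spectrum_of (X *m Y^t* *m Y *m X^t*) c ->
  \sum_(i in K) (a`_i - lam`_i) <=
  \sum_(i < #|K|) (a`_i - (rev L)`_i) * (1 - (rev c)`_i).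
Proof.
move=> Xu Yu XA aX AL takeL lamY cXY.
have [Z Zu XZ] := unitary_complement Xu.
have hA := spectrum_of_ctrmx AL.
have ZX : Z *m X^t* = 0 by rewrite -[Z *m _]trmxCK ctrmxM trmxCK XZ trmx0 map_mx0.
have [an sa [U Uu eU]] := aX.
(* The opposite of the block is diagonalized so that its eigenvalues [b] come out in increasing
   order. *)
have [d [dr sd [V Vu eV]]] : exists d, spectrum_of (- (Z *m A *m Z^t*)) d.
  by apply: spectrum_of_hermitian; rewrite ctrmxN ctrmx_congr.
pose b := [seq - x | x <- d].
have br : size b = r by rewrite size_map.
have sb : sorted <=%R b by apply: homo_sorted sd => x y /= xy; rewrite lerN2.
have {}eV : Z *m A *m Z^t* = V^t* *m rdiag r (nth 0 b) *m V.
  have -> : rdiag r (nth 0 b) = - rdiag r (nth 0 d).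
    rewrite -[RHS]raddfN; congr diag_mx; apply/rowP => i.
    by rewrite !mxE (nth_map 0) ?dr // rmorphN.
  by rewrite mulmxN mulNmx -eV opprK.
pose X' := U *m X; pose Z' := V *m Z.
have X'u : X' \is unitarymx by exact: mul_unitarymx Uu Xu.
have Z'u : Z' \is unitarymx by exact: mul_unitarymx Vu Zu.
pose T := col_mx X' Z'.
have TE : T^t* = row_mx (X'^t*) (Z'^t*) by rewrite tr_col_mx map_row_mx.
have X'Z' : X' *m Z'^t* = 0 by rewrite ctrmxM -mulmxA (mulmxA X) XZ mul0mx mulmx0.
have Z'X' : Z' *m X'^t* = 0 by rewrite ctrmxM -mulmxA (mulmxA Z) ZX mul0mx mulmx0.
have Tu : T \is unitarymx.
  apply/unitarymxP; rewrite TE mul_col_row X'Z' Z'X' (unitarymxP X'u) (unitarymxP Z'u).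
  by rewrite -scalar_mx_block.
(* One off-diagonal block vanishes by invariance, the other by Hermitian symmetry. *)
have XAZ : X *m A *m Z^t* = 0 by rewrite XA -mulmxA XZ mulmx0.
have ZAX : Z *m A *m X^t* = 0.
  by rewrite -[LHS]trmxCK ctrmxM trmxCK (ctrmxM Z) hA mulmxA XAZ trmx0 map_mx0.
have TAT : T *m A *m T^t* = rdiag (n + r) (nth 0 (a ++ b)).
  rewrite rdiag_cat // mul_col_mx TE mul_col_row /X' /Z' !ctrmxM.
  have E p q (P : 'M[C]_(p, n + r)) (Q : 'M[C]_(q, n + r)) (P1 : 'M[C]_p) (Q1 : 'M[C]_q) :
      P1 *m P *m A *m (Q^t* *m Q1^t*) = P1 *m (P *m A *m Q^t*) *m Q1^t*.
    by rewrite !mulmxA.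
  rewrite !E XAZ ZAX eU eV !(mulmx0, mul0mx) !mulmxA.
  by rewrite (unitarymxP Uu) (unitarymxP Vu) !mul1mx !mulmxtVK.
have AE : A = T^t* *m rdiag (n + r) (nth 0 (a ++ b)) *m T.
  by rewrite -TAT !mulmxA ctrmx_mul_unitary // mul1mx mulmxKtV.
(* [L] is the sorted list [a ++ b] and starts with [a], hence it is [a ++ rev b]; its order then
   puts every entry of [b] below every entry of [a]. *)
have LE : L = sort >=%R (a ++ b).
  apply: (spectrum_of_uniq AL _ erefl); rewrite {1}AE; apply: spectrum_of_perm => //.
  by rewrite size_cat an br.
have sL : sorted >=%R L by case: AL.
have pdrop : perm_eq (drop n L) b.
  by rewrite -(perm_cat2l a) -{1}takeL cat_take_drop LE perm_sort.
have dropE : drop n L = rev b.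
  apply: (sorted_eq ge_trans ge_anti); last by rewrite perm_sym perm_rev perm_sym.
    exact: drop_sorted.
  by rewrite rev_sorted.
have LE' : L = a ++ rev b by rewrite -dropE -takeL cat_take_drop.
have ba x y : x \in b -> y \in a -> x <= y.
  move=> xb ya; move: sL; rewrite LE' (sorted_pairwise ge_trans) pairwise_cat.
  by case/and3P => /allrelP/(_ y x ya) + _ _; rewrite mem_rev; apply.
rewrite [in rev L]LE' rev_cat revK.
have TYE : Y *m T^t* = row_mx (Y *m X'^t*) (Y *m Z'^t*) by rewrite TE mul_mx_row.
have TYE' : T *m Y^t* = col_mx ((Y *m X'^t*)^t*) ((Y *m Z'^t*)^t*).
  by rewrite -[LHS]trmxCK ctrmxM trmxCK TYE tr_row_mx map_col_mx.
set G := Y *m X'^t* in TYE TYE' *; set S := Y *m Z'^t* in TYE TYE' *.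
have GS : G *m G^t* + S *m S^t* = 1%:M.
  rewrite -mul_row_col -TYE -TYE' -mulmxA (mulmxA _ T) ctrmx_mul_unitary // mul1mx.
  by rewrite (unitarymxP Yu).
have GSlam : spectrum_of (G *m rdiag n (nth 0 a) *m G^t* + S *m rdiag r (nth 0 b) *m S^t*) lam.
  suff <- : Y *m A *m Y^t* = G *m rdiag n (nth 0 a) *m G^t* + S *m rdiag r (nth 0 b) *m S^t*.
    by [].
  rewrite {1}AE !mulmxA TYE -mulmxA TYE' rdiag_cat // mul_row_block !mulmx0 addr0 add0r.
  by rewrite mul_row_col.
(* [G^* G] is a unitary conjugate of the matrix whose eigenvalues are the squared cosines. *)
have Gc : spectrum_of (G^t* *m G) c.
  suff -> : G^t* *m G = U *m (X *m Y^t* *m Y *m X^t*) *m U^t*.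
    exact: spectrum_of_conj cXY Uu.
  by rewrite ctrmxM trmxCK /G ctrmxM !mulmxA.
exact: block_majorization an sa br sb ba GS GSlam Gc.
Qed.

End Reduction.

(** * Coordinates in an inner product space *)

Section Scalars.
Variables (R : realType) (k : scalars).
Local Notation F := (scalar_field R k).
Local Notation C := R[i].
Local Notation toC := (@scalar_toC R k).

Lemma scalar_toC_conj (x : F) : toC (sconj R k x) = (toC x)^*.
Proof. by case: k x => x //; exact/esym/conjc_real. Qed.

Lemma map_toC_conj m n (M : 'M[F]_(m, n)) :
  (map_mx toC M)^t* = map_mx toC (map_mx (sconj R k) M^T).
Proof. by apply/matrixP => i j; rewrite !mxE scalar_toC_conj. Qed.

End Scalars.

Section RealPsd.
Variable R : realType.
Local Notation C := R[i].

(** With [v = p + i q], the symmetry of [G] cancels the cross terms and leaves the sum of the real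
    forms at [p] and [q]. *)
Lemma quad_real_ge0 n (G : 'M[R]_n) : G^T = G ->
  (forall x : 'rV[R]_n, 0 <= (x *m G *m x^T) 0 0) ->
  forall v : 'rV[C]_n, 0 <= quad (map_mx (real_complex R) G) v.
Proof.
move=> Gs G0 v; pose p := map_mx (@complex.Re R) v; pose q := map_mx (@complex.Im R) v.
have vE : v = map_mx (real_complex R) p + 'i%C *: map_mx (real_complex R) q.
  by apply/rowP => i; rewrite !mxE -complexE.
have vC : v^t* = map_mx (real_complex R) p^T - 'i%C *: map_mx (real_complex R) q^T.
  have rcC m m' (M : 'M[R]_(m, m')) :
      (map_mx (real_complex R) M)^t* = map_mx (real_complex R) M^T.
    by apply/matrixP => i j; rewrite !mxE; exact: conjc_real.
  have iC : ('i%C : C)^* = - 'i%C by apply/eqP; rewrite eq_complex /= oppr0 !eqxx.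
  rewrite vE ctrmxD rcC.
  have -> : ('i%C *: map_mx (real_complex R) q)^t* = ('i%C : C)^* *: (map_mx (real_complex R) q)^t*.
    by apply/matrixP => i j; rewrite !mxE; exact: rmorphM.
  by rewrite iC rcC scaleNr.
have sym : q *m G *m p^T = p *m G *m q^T.
  have -> : q *m G *m p^T = (p *m G *m q^T)^T by rewrite !trmx_mul trmxK Gs mulmxA.
  by apply/matrixP => i j; rewrite !ord1 mxE.
rewrite /quad vC {1}vE mulmxDl mulmxBr !mulmxDl -!scalemxAl -!scalemxAr -!map_mxM sym.
rewrite scalerA -expr2 sqr_i scaleN1r opprD opprK addrA addrK -map_mxD mxE.
by rewrite (lecR 0) mxE addr_ge0.
Qed.

End RealPsd.

Lemma quad_toC_ge0 (R : realType) (k : scalars) n (G : 'M[scalar_field R k]_n) :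
  map_mx (sconj R k) G^T = G ->
  (forall x : 'rV[scalar_field R k]_n, 0 <= (x *m G *m (map_mx (sconj R k) x)^T) 0 0) ->
  forall x, 0 <= quad (map_mx (@scalar_toC R k) G) x.
Proof.
case: k G => G /= hG G0.
  apply: quad_real_ge0 => [|x]; first by rewrite -[RHS]hG map_mx_id.
  by have := G0 x; rewrite map_mx_id.
move=> x; suff -> : quad (map_mx idfun G) x = (x *m G *m (map_mx (@Num.conj R[i]) x)^T) 0 0.
  exact: G0.
have -> : map_mx idfun G = G by exact: map_mx_id.
by rewrite /quad map_trmx.
Qed.

Section Coordinates.
Variables (R : realType) (k : scalars) (H : vectType (scalar_field R k)).
Variable dot : {dot H for @sconj R k}.
Local Notation F := (scalar_field R k).
Local Notation C := R[i].
Local Notation toC := (@scalar_toC R k).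

Definition gram n (v : 'I_n -> H) : 'M[F]_n := \matrix_(i, j) dot (v i) (v j).

Lemma dot_sum n (v : 'I_n -> H) (x y : 'rV[F]_n) :
  dot (\sum_i x 0 i *: v i) (\sum_j y 0 j *: v j) =
    (x *m gram v *m (map_mx (sconj R k) y)^T) 0 0.
Proof.
rewrite linear_sumr mxE; apply: eq_bigr => j _.
rewrite linearZr /= mxE mulrC; congr (_ * _); last by rewrite !mxE.
rewrite linear_sumlz; apply: eq_bigr => i _.
by rewrite linearZl /= !mxE.
Qed.

Lemma dotC u v : dot u v = sconj R k (dot v u).
Proof. by rewrite (hermC dot) expr0 mul1r. Qed.

Lemma gram_ctrmx n (v : 'I_n -> H) : map_mx (sconj R k) (gram v)^T = gram v.
Proof. by apply/matrixP => i j; rewrite !mxE -dotC. Qed.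

(** A vector in the kernel of the Gram matrix would give a combination of zero norm. *)
Lemma gram_unit n (v : 'I_n -> H) :
  (forall x : 'rV[F]_n, \sum_i x 0 i *: v i = 0 -> x = 0) -> gram v \in unitmx.
Proof.
move=> vfree; rewrite -row_free_unit -kermx_eq0; apply/rowV0P => x /sub_kermxP xG.
apply: vfree; apply: contraTeq isT => w0.
by have := @neq0_dnorm_gt0 _ _ _ dot _ w0; rewrite dot_sum xG mul0mx mxE ltxx.
Qed.

Lemma gram_psd n (v : 'I_n -> H) (x : 'rV[C]_n) : 0 <= quad (map_mx toC (gram v)) x.
Proof.
apply: quad_toC_ge0; first exact: gram_ctrmx.
move=> y; rewrite -dot_sum; set u := \sum_i _.
have [->|u0] := eqVneq u 0; first by rewrite linear0r.
exact/ltW/neq0_dnorm_gt0.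
Qed.

(* The coordinates are those in an orthonormal basis of the complexification of [H]. *)
Lemma isometric_coordinates : exists phi : H -> 'rV[C]_(\dim {:H}),
  [/\ forall (a : F) u w, phi (a *: u + w) = toC a *: phi u + phi w,
      forall u w, (phi u *m (phi w)^t* ) 0 0 = toC (dot u w),
      forall p (B : 'M[C]_(_, p)), (forall u, phi u *m B = 0) -> B = 0
    & forall f : 'End(H), exists B, forall u, phi (f u) = phi u *m B].
Proof.
set N := \dim _; pose e := vbasis {:H}; have eb : basis_of {:H} e := vbasisP _.
pose v (i : 'I_N) := e`_i.
have vE (u : H) : u = \sum_i passmx.rVof e u 0 i *: v i.
  by rewrite -[LHS](passmx.rVofK eb).
have Gu : gram v \in unitmx.
  apply: gram_unit => x x0; have := passmx.vecofK eb x.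
  by rewrite /passmx.vecof x0 => <-; apply/rowP => i; rewrite !mxE linear0.
have hG : (map_mx toC (gram v))^t* = map_mx toC (gram v).
  by rewrite map_toC_conj gram_ctrmx.
have [g gG] := spectrum_of_hermitian hG.
have g0 := spectrum_of_ge0 gG (gram_psd v).
have [gn _ [U Uu eG]] := gG.
pose D : 'M[C]_N := rdiag N (fun i => Num.sqrt g`_i).
have DD : D *m D = rdiag N (nth 0 g).
  by rewrite mul_rdiag; apply: eq_rdiag => i _; rewrite -expr2 sqr_sqrtr.
(* [K *m K^t*] is the Gram matrix, so multiplying coordinates by [K] turns [dot] into the standard
   Hermitian product. *)
pose K := U^t* *m D.
have KK : K *m K^t* = map_mx toC (gram v).
  have Dh : D^t* = D by exact: ctrmx_rdiag.
  by rewrite /K ctrmxM trmxCK Dh mulmxA -(mulmxA (U^t*) D D) DD -eG.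
clearbody K; have Ku : K \in unitmx.
  have : map_mx toC (gram v) \in unitmx by rewrite map_unitmx.
  by rewrite -KK unitmx_mul; case/andP => Ku _; exact: Ku.
pose c u := map_mx toC (passmx.rVof e u).
have cV x : c (passmx.vecof e x) = map_mx toC x by rewrite /c passmx.vecofK.
exists (fun u => c u *m K); split.
- by move=> a u w; rewrite /c passmx.rVof_linear map_mxD map_mxZ mulmxDl scalemxAl.
- move=> u w; rewrite ctrmxM mulmxA -(mulmxA _ K) KK /c map_toC_conj -!map_mxM mxE.
  by rewrite -map_trmx -dot_sum -!vE.
(* The basis vectors are sent to the rows of [K], which span over [R[i]] even when the scalars are
   real. *)
- move=> p B B0; suff KB : K *m B = 0 by rewrite -(mulKmx Ku B) KB mulmx0.
  apply/row_matrixP => i; rewrite rowE row0 -(map_delta_mx toC) -cV mulmxA; exact: B0.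
move=> f; exists (invmx K *m map_mx toC (passmx.mxof e e f) *m K) => u.
have KV : K *m invmx K = 1%:M := mulmxV Ku.
rewrite /= /c (passmx.rVof_app e eb) map_mxM.
set B := map_mx toC (passmx.mxof e e f).
by rewrite -(mulmxA _ K) -(mulmxA (invmx K)) (mulmxA K (invmx K)) KV mul1mx mulmxA.
Qed.

End Coordinates.

(** * Orthonormal frames of subspaces *)

Section Subspaces.
Variables (R : realType) (k : scalars) (H : vectType (scalar_field R k)).
Variable dot : {dot H for @sconj R k}.
Local Notation F := (scalar_field R k).
Local Notation C := R[i].
Local Notation toC := (@scalar_toC R k).
Variables (N : nat) (phi : H -> 'rV[C]_N).
Hypothesis phi_lin : forall (a : F) u w, phi (a *: u + w) = toC a *: phi u + phi w.
Hypothesis phi_iso : forall u w, (phi u *m (phi w)^t* ) 0 0 = toC (dot u w).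

Lemma phi_sum n (v : 'I_n -> H) (x : 'rV[F]_n) :
  phi (\sum_i x 0 i *: v i) = map_mx toC x *m \matrix_i phi (v i).
Proof.
have phi0 : phi 0 = 0.
  have /eqP := phi_lin 1 0 0; rewrite scaler0 addr0 rmorph1 scale1r.
  by rewrite -subr_eq subrr eq_sym => /eqP.
have phiD u w : phi (u + w) = phi u + phi w.
  by have := phi_lin 1 u w; rewrite scale1r rmorph1 scale1r.
have phiZ a u : phi (a *: u) = toC a *: phi u.
  by have := phi_lin a u 0; rewrite !addr0 phi0 addr0.
rewrite (big_morph _ phiD phi0) mulmx_sum_row; apply: eq_bigr => i _.
by rewrite phiZ mxE rowK.
Qed.

(* The rows of [E] are the coordinates of an orthonormal basis of the complexified [V]. *)
Lemma orthonormal_frame (V : vectType F) (iota : {linear V -> H}) n :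
  injective iota -> \dim {:V} = n -> (n <= N)%N -> exists E : 'M[C]_(n, N),
  [/\ E \is unitarymx,
      forall u, phi (iota u) *m E^t* *m E = phi (iota u),
      forall p (B : 'M[C]_(N, p)), (forall u, phi (iota u) *m B = 0) -> E *m B = 0
    & forall (f : 'End(V)) (B : 'M[C]_N),
        (forall u, phi (iota (f u)) = phi (iota u) *m B *m E^t* *m E) ->
        map_poly toC (charpoly f) = char_poly (E *m B *m E^t*)].
Proof.
move=> iota_inj <- nN; set m := \dim _.
pose e := vbasis {:V}; have eb : basis_of {:V} e := vbasisP _.
pose v (i : 'I_m) := iota e`_i; pose W : 'M[C]_(m, N) := \matrix_i phi (v i).
have iota_vecof x : iota (passmx.vecof e x) = \sum_i x 0 i *: v i.
  by rewrite linear_sum; apply: eq_bigr => i _; rewrite linearZ.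
have phiE u : phi (iota u) = map_mx toC (passmx.rVof e u) *m W.
  by rewrite -{1}[u](passmx.rVofK eb) iota_vecof phi_sum.
have Gu : gram dot v \in unitmx.
  apply: gram_unit => x; rewrite -iota_vecof => /eqP.
  rewrite -(linear0 iota) (inj_eq iota_inj) => /eqP x0.
  have := passmx.vecofK eb x; rewrite x0 => <-.
  by apply/rowP => i; rewrite !mxE linear0.
have WW : W *m W^t* = map_mx toC (gram dot v).
  apply/matrixP => i j; rewrite !mxE -phi_iso !mxE; apply: eq_bigr => l _.
  by rewrite !mxE.
have Wf : row_free W.
  apply/row_freeP; exists (W^t* *m invmx (map_mx toC (gram dot v))).
  by rewrite mulmxA WW mulmxV // map_unitmx.
pose E := schmidt W.
have Eu : E \is unitarymx by exact: schmidt_unitarymx.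
have /submxP[T WE] : (W <= E)%MS := schmidt_sub W.
have /submxP[Q EW] : (E <= W)%MS by rewrite (eqmx_schmidt_free Wf).
clearbody E.
(* [E = Q T E] and the rows of [E] are orthonormal, so the change of basis [T] is invertible. *)
have TQ : Q *m T = 1%:M.
  by rewrite -(mulmxtVK (Q *m T) Eu) -(mulmxA Q T) -WE -EW (unitarymxP Eu).
exists E; split => //.
- by move=> u; rewrite phiE WE mulmxA (mulmxtVK _ Eu).
- move=> p B B0; suff WB : W *m B = 0 by rewrite EW -mulmxA WB mulmx0.
  apply/row_matrixP => i; rewrite rowE row0 -(map_delta_mx toC) mulmxA.
  by rewrite -[delta_mx 0 i](passmx.vecofK eb) -phiE.
move=> f B fB.
(* The matrix of [f] in the basis [e] is intertwined by [W = T E] with [B] followed by projection;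
   multiplying by [E^t*] leaves [T] as a similarity to the compressed matrix. *)
have FW : map_mx toC (passmx.mxof e e f) *m W = W *m B *m E^t* *m E.
  apply/row_matrixP => i; rewrite !row_mul !rowE -!(map_delta_mx toC) -map_mxM.
  rewrite passmx.mul_mxof -phiE fB phiE (passmx.vecofK eb).
  by [].
rewrite /charpoly map_char_poly; apply/esym/(@char_poly_similar _ _ _ _ T).
  by have [] := mulmx1_unit TQ.
have := congr1 (mulmx^~ (E^t*)) FW; rewrite /= WE.
set F' := map_mx toC _; rewrite -!mulmxA (unitarymxP Eu) !mulmx1 => ->.
by rewrite !mulmxA.
Qed.

End Subspaces.

(** * The bound *)

Section MatrixMajorization.
Variable R : realType.
Local Notation C := R[i].
Implicit Types s t : seq R.

(** Everything is rewritten in the frame [S] of the sum of the two subspaces, where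
    [invariant_majorization] applies. *)
Lemma matrix_majorization N n m (A : 'M[C]_N) (X Y : 'M[C]_(n, N)) (S : 'M[C]_(m, N))
    (l a L lam c : seq R) :
  X \is unitarymx -> Y \is unitarymx -> S \is unitarymx ->
  X *m S^t* *m S = X -> Y *m S^t* *m S = Y -> X *m A = X *m A *m X^t* *m X ->
  spectrum_of A l -> spectrum_of (X *m A *m X^t*) a -> a = take n l ->
  spectrum_of (S *m A *m S^t*) L -> spectrum_of (Y *m A *m Y^t*) lam ->
  spectrum_of (X *m (Y^t* *m Y) *m X^t*) c ->
  [/\ (n <= m)%N, take n L = a, forall i, (i < n)%N -> lam`_i <= a`_i
    & forall K : {set 'I_n}, \sum_(i in K) (a`_i - lam`_i) <=
        \sum_(i < #|K|) (a`_i - (rev L)`_i) * (1 - (rev c)`_i)].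
Proof.
move=> Xu Yu Su XS YS XA Al Xa al SL Ylam XYc.
have SX : S^t* *m S *m X^t* = X^t*.
  by rewrite -{2}XS !ctrmxM trmxCK mulmxA.
have SY : S^t* *m S *m Y^t* = Y^t*.
  by rewrite -{2}YS !ctrmxM trmxCK mulmxA.
pose X1 := X *m S^t*; pose Y1 := Y *m S^t*.
have X1u : X1 \is unitarymx.
  by apply/unitarymxP; rewrite /X1 ctrmxM trmxCK mulmxA XS (unitarymxP Xu).
have Y1u : Y1 \is unitarymx.
  by apply/unitarymxP; rewrite /Y1 ctrmxM trmxCK mulmxA YS (unitarymxP Yu).
have nm : (n <= m)%N by rewrite -(mxrank_unitary X1u) rank_leq_col.
have al_nth i : (i < n)%N -> a`_i = l`_i by move=> lin; rewrite al nth_take.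
have X1a : spectrum_of (X1 *m (S *m A *m S^t*) *m X1^t*) a.
  suff -> : X1 *m (S *m A *m S^t*) *m X1^t* = X *m A *m X^t* by [].
  rewrite /X1 ctrmxM trmxCK !mulmxA XS -!mulmxA; congr (_ *m (_ *m _)).
  by rewrite mulmxA SX.
have Y1lam : spectrum_of (Y1 *m (S *m A *m S^t*) *m Y1^t*) lam.
  suff -> : Y1 *m (S *m A *m S^t*) *m Y1^t* = Y *m A *m Y^t* by [].
  rewrite /Y1 ctrmxM trmxCK !mulmxA YS -!mulmxA; congr (_ *m (_ *m _)).
  by rewrite mulmxA SY.
have takeL : take n L = a.
  have sizeL := spectrum_of_size SL.
  apply: (@eq_from_nth _ 0); first by rewrite size_takel ?sizeL // (spectrum_of_size Xa).
  move=> i; rewrite size_takel ?sizeL // => lin; rewrite nth_take //.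
  (* Interlacing on both sides: [L] is dominated by the spectrum of [A], whose top part is [a], and
     [a] belongs to a compression of the matrix with spectrum [L]. *)
  apply/le_anti/andP; split.
    rewrite al_nth //; apply: (spectrum_of_le SL Al Su) => //.
    exact: leq_trans nm.
  exact: (spectrum_of_le X1a SL X1u).
split=> // [i lin|K].
  by rewrite al_nth //; apply: (spectrum_of_le Ylam Al Yu).
have X1A : X1 *m (S *m A *m S^t*) = X1 *m (S *m A *m S^t*) *m X1^t* *m X1.
  transitivity (X *m A *m X^t* *m X *m S^t*); first by rewrite -XA /X1 !mulmxA XS.
  rewrite /X1 ctrmxM trmxCK !mulmxA XS -!mulmxA.
  by rewrite (mulmxA (S^t*) S) (mulmxA (S^t* *m S) (X^t*)) SX.
have X1c : spectrum_of (X1 *m Y1^t* *m Y1 *m X1^t*) c.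
  suff -> : X1 *m Y1^t* *m Y1 *m X1^t* = X *m (Y^t* *m Y) *m X^t* by [].
  rewrite /X1 /Y1 (ctrmxM X) (ctrmxM Y) !trmxCK !mulmxA XS -!mulmxA.
  by rewrite (mulmxA (S^t*) S) SX.
have [r mE] : exists r, m = (n + r)%N by exists (m - n)%N; rewrite subnKC.
clearbody X1 Y1; subst m.
exact: invariant_majorization X1u Y1u X1A X1a SL takeL Y1lam X1c.
Qed.

(** The upper bound is interlacing with [Y^t* *m Y], whose nonzero eigenvalues are those of
    [Y *m Y^t* = 1]. *)
Lemma cos2_bounds N n (X Y : 'M[C]_(n, N)) c : X \is unitarymx -> Y \is unitarymx ->
  spectrum_of (X *m (Y^t* *m Y) *m X^t*) c -> forall i, (0 <= c`_i <= 1).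
Proof.
move=> Xu Yu Xc i; apply/andP; split.
  apply: (spectrum_of_ge0 Xc) => v.
  suff -> : X *m (Y^t* *m Y) *m X^t* = (X *m Y^t*) *m (X *m Y^t*)^t* by exact: quad_gram_ge0.
  by rewrite ctrmxM trmxCK !mulmxA.
have [lin|ni] := ltnP i n; last by rewrite nth_default ?ler01 // (spectrum_of_size Xc).
have [t Yt] := spectrum_of_gram Y.
apply: (le_trans (spectrum_of_le Xc Yt Xu (fun v => lexx _) lin)).
have Y1 : spectrum_of (Y *m Y^t*) (nseq n 1).
  rewrite (unitarymxP Yu); have := @spectrum_of_rdiag R n (nseq n 1).
  rewrite (@eq_rdiag _ n _ (fun=> 1)) => [|j jn]; last by rewrite nth_nseq jn.
  rewrite rdiag_cst; apply; first by rewrite size_nseq.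
  by elim: {+}n => [//|[|k] IH] //=; rewrite lexx.
by rewrite -(spectrum_of_gram_nth Y1 Yt) nth_nseq lin.
Qed.

(** Ky Fan's inequality for the diagonal matrix of [y] and the first [k] coordinate vectors. *)
Lemma sum_prefix_le_sort (y : seq R) k : (k <= size y)%N ->
  \sum_(i < k) y`_i <= \sum_(i < k) (sort >=%R y)`_i.
Proof.
move=> ky; have := spectrum_of_perm (erefl (size y)) (unitarymx1 R (size y)).
rewrite ctrmx1 mul1mx mulmx1 => specy.
have := ky_fan specy (rowsub_widen_unitary ky (unitarymx1 R (size y))).
rewrite mul_rowsub_mx trmx_mxsub map_mxsub -mxsub_mul ctrmx1 mulmx1 mul1mx.
rewrite -(lecR (\sum_(i < k) y`_i)); apply: le_trans.
rewrite rmorph_sum; apply: ler_sum => i _.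
by rewrite !mxE eqxx.
Qed.

Lemma sort_prefix_attained (x : seq R) n k : size x = n -> (k <= n)%N ->
  exists2 K : {set 'I_n}, #|K| = k &
    \sum_(i < k) (sort >=%R x)`_i = \sum_(i in K) x`_i.
Proof.
move=> xn kn; have /tuple_permP[p ep] : perm_eq (sort >=%R x) (Tuple (introT eqP xn)).
  by rewrite perm_sort.
have f_inj : injective (fun i : 'I_k => p (widen_ord kn i)).
  by move=> i j /perm_inj /(congr1 val) /= /val_inj.
exists [set p (widen_ord kn i) | i : 'I_k]; first by rewrite card_imset // card_ord.
rewrite big_imset /=; last by move=> i j _ _; exact: f_inj.
apply: eq_bigr => i _; rewrite ep.
rewrite -[i : nat]/(val (widen_ord kn i)) (nth_map (widen_ord kn i)).
  by rewrite nth_ord_enum (tnth_nth 0).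
by rewrite size_enum_ord; exact: ltn_ord.
Qed.

(** The [k] largest entries of [x] occupy some set [K], and a prefix sum of [y] in its given order
    is at most the sorted one. *)
Lemma weak_maj_subset_sums (x y : seq R) n : size x = n -> size y = n ->
  (forall K : {set 'I_n}, \sum_(i in K) x`_i <= \sum_(i < #|K|) y`_i) -> weak_maj x y.
Proof.
move=> xn yn xy; split; first by rewrite xn.
move=> k /andP[_]; rewrite xn => kn.
have [K Kk ->] := sort_prefix_attained xn kn.
by apply: le_trans (xy K) _; rewrite Kk sum_prefix_le_sort // yn.
Qed.

Lemma nth_vsub s t i : size s = size t -> (vsub s t)`_i = s`_i - t`_i.
Proof.
move=> st; have [si|si] := ltnP i (size s).
  by rewrite (nth_map (0, 0)) ?nth_zip //= size_zip -st minnn.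
by rewrite !nth_default ?subrr // -?st // size_map size_zip -st minnn.
Qed.

Lemma nth_vmul s t i : size s = size t -> (vmul s t)`_i = s`_i * t`_i.
Proof.
move=> st; have [si|si] := ltnP i (size s).
  by rewrite (nth_map (0, 0)) ?nth_zip //= size_zip -st minnn.
by rewrite !nth_default ?mul0r // -?st // size_map size_zip -st minnn.
Qed.

Lemma size_vsub s t n : size s = n -> size t = n -> size (vsub s t) = n.
Proof. by move=> sn tn; rewrite size_map size_zip sn tn minnn. Qed.

Lemma size_vmul s t n : size s = n -> size t = n -> size (vmul s t) = n.
Proof. by move=> sn tn; rewrite size_map size_zip sn tn minnn. Qed.

Lemma sin2_acos_sqrt (c : seq R) : (forall i, 0 <= c`_i <= 1) ->
  [seq sin th ^+ 2 | th <- [seq acos (Num.sqrt x) | x <- c]] = [seq 1 - x | x <- c].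
Proof.
move=> c01; rewrite -map_comp; apply/eq_in_map => x /(nthP 0)[i _ <-] /=.
have /andP[c0 c1] := c01 i.
rewrite sin_acos; last first.
  by rewrite (le_trans _ (sqrtr_ge0 _)) ?lerN10 //= -sqrtr1 ler_sqrt.
by rewrite sqr_sqrtr // sqr_sqrtr // subr_ge0.
Qed.

End MatrixMajorization.

(** * Projectors and compressions in coordinates *)

Section SubspaceFrame.
Variables (R : realType) (k : scalars) (H : vectType (scalar_field R k)).
Variable dot : {dot H for @sconj R k}.
Local Notation F := (scalar_field R k).
Local Notation C := R[i].
Local Notation toC := (@scalar_toC R k).

Lemma restr_opE (Z : {vspace H}) (B : 'End(H)) u :
  restr_op Z B u = vsproj Z (B (vsval u)).
Proof.
have lin : linear (fun u : subvs_of Z => vsproj Z (B (vsval u))).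
  by move=> a x y; rewrite !linearP.
pose G : {linear subvs_of Z -> subvs_of Z} := HB.pack
  (fun u : subvs_of Z => vsproj Z (B (vsval u))) (GRing.isLinear.Build _ _ _ _ _ lin).
exact: (lfunE G).
Qed.

Lemma dim_subvs (Z : {vspace H}) : \dim {:subvs_of Z} = \dim Z.
Proof. by rewrite dimvf. Qed.

Variables (N : nat) (phi : H -> 'rV[C]_N).
Hypothesis phi_lin : forall (a : F) u w, phi (a *: u + w) = toC a *: phi u + phi w.
Hypothesis phi_iso : forall u w, (phi u *m (phi w)^t* ) 0 0 = toC (dot u w).

(** The frame of the inclusion of [Z] also represents the projector, as [E^t* *m E], and turns
    spectra of compressed matrices into values of [Lambda]. *)
Lemma subspace_frame (Z : {vspace H}) n : \dim Z = n -> (n <= N)%N ->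
  exists E : 'M[C]_(n, N),
  [/\ E \is unitarymx,
      forall p (B : 'M[C]_(N, p)), (forall u, u \in Z -> phi u *m B = 0) -> E *m B = 0,
      forall u, u \in Z -> phi u *m E^t* *m E = phi u,
      forall u, phi (orthoproj dot Z u) = phi u *m (E^t* *m E)
    & forall (f : 'End(H)) (B : 'M[C]_N), (forall u, u \in Z -> f u \in Z) ->
        (forall u, phi (f u) = phi u *m B) -> forall s,
        spectrum_of (E *m B *m E^t*) s -> Lambda (restr_op Z f) = s].
Proof.
move=> Zn nN.
have [E [Eu phiE EB charE]] := orthonormal_frame phi_lin phi_iso
  (@val_inj _ _ _ : injective (vsval : subvs_of Z -> H)) (etrans (dim_subvs Z) Zn) nN.
have phiZ u : u \in Z -> phi u *m E^t* *m E = phi u.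
  by move=> uZ; have := phiE (vsproj Z u); rewrite /= vsprojK.
have projE u : phi (orthoproj dot Z u) = phi u *m (E^t* *m E).
  rewrite -(phiZ _ (orthoproj_mem dot Z u)) [RHS]mulmxA; congr (_ *m E).
  have phiB w w' : phi (w - w') = phi w - phi w'.
    by rewrite addrC -scaleN1r phi_lin rmorphN1 scaleN1r addrC.
  apply/eqP; rewrite eq_sym -subr_eq0 -mulmxBl -phiB; apply/eqP.
  (* The residual [w] is orthogonal to [Z], hence to all rows of the frame. *)
  set w := u - _; have : E *m (phi w)^t* = 0.
    apply: EB => z; apply/matrixP => i j; rewrite !ord1 phi_iso mxE.
    by rewrite dotC orthoproj_ortho ?subvsP // rmorph0 rmorph0.
  by move/(congr1 (fun M => M^t*)); rewrite ctrmxM trmxCK trmx0 map_mx0.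
exists E; split=> //.
  by move=> p B B0; apply: EB => u; exact/B0/subvsP.
move=> f B fZ fB s sB; have [_ ss _] := sB.
apply: LambdaE => //; rewrite (charE _ B) ?(spectrum_of_char_poly sB) // => u.
by rewrite restr_opE /= vsprojK ?fZ ?subvsP // -fB phiZ ?fZ ?subvsP.
Qed.

End SubspaceFrame.

Theorem theorem2p2 (R : realType) (k : scalars) (H : vectType (scalar_field R k))
    (dot : {dot H for @sconj R k}) (A : 'End(H)) (X Y : {vspace H})
    (herm_A : hermitian_op dot A)
    (dim_XY : \dim X = \dim Y)
    (inv_X : (A @: X <= X)%VS)
    (top_X : Lambda (restr_op X A) = take (\dim X) (Lambda A)) :
  let LX := Lambda (compression dot X A) in
  let LY := Lambda (compression dot Y A) in
  let sin2 := [seq sin t ^+ 2 | t <- Theta dot X Y] in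
  weak_maj [seq `|d| | d <- vsub LX LY] (vmul (Spr dot A X Y) sin2)
  /\ (forall d : R, d \in vsub LX LY -> 0 <= d)
  /\ weak_maj (vsub LX LY)
       (vmul [seq l - lambda_min dot A X Y | l <- LX] sin2).
Proof.
move=> LX LY sin2; rewrite /LX /LY /sin2 /lambda_min /Spr /Theta {LX LY sin2}.
have := isometric_coordinates dot; set N := \dim _.
move=> -[phi [phi_lin phi_iso phi_span phi_mx]].
have [B AB] := phi_mx A.
(* [herm_A] only speaks of vectors in the image of [phi], so the spanning property is used once on
   each side. *)
have hB : B^t* = B.
  apply/esym/eqP; rewrite -subr_eq0; apply/eqP; apply: (phi_span N) => u.
  rewrite -[LHS]trmxCK; set D := phi u *m _.
  suff -> : D^t* = 0 by rewrite trmx0 map_mx0.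
  apply: (phi_span 1%N) => w; rewrite -[LHS]trmxCK ctrmxM trmxCK.
  suff -> : D *m (phi w)^t* = 0 by rewrite trmx0 map_mx0.
  have DE : D *m (phi w)^t* = phi (A u) *m (phi w)^t* - phi u *m (phi (A w))^t*.
    by rewrite !AB ctrmxM mulmxA -mulmxBl -mulmxBr.
  by apply/matrixP => i j; rewrite DE !ord1 [LHS]mxE [X in _ + X]mxE !phi_iso herm_A subrr mxE.
have dimN (Z : {vspace H}) : (\dim Z <= N)%N by rewrite dimvS ?subvf.
set n := \dim X in top_X *.
have [EX [EXu EXspan EXid EXproj EXspec]] :=
  subspace_frame phi_lin phi_iso (erefl n) (dimN X).
have [EY [EYu EYspan EYid EYproj EYspec]] :=
  subspace_frame phi_lin phi_iso (esym dim_XY) (dimN X).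
have [ES [ESu ESspan ESid ESproj ESspec]] :=
  subspace_frame phi_lin phi_iso (erefl (\dim (X + Y))) (dimN (X + Y)%VS).
have spec m (E : 'M[R[i]]_(m, N)) : exists s, spectrum_of (E *m B *m E^t*) s.
  by apply: spectrum_of_hermitian; exact: ctrmx_congr.
have [l Bl] := spectrum_of_hermitian hB.
have [a Xa] := spec _ EX; have [lam Ylam] := spec _ EY; have [L SL] := spec _ ES.
have [c Xc] : exists c, spectrum_of (EX *m (EY^t* *m EY) *m EX^t*) c.
  by apply/spectrum_of_hermitian/ctrmx_congr; rewrite ctrmxM trmxCK.
(* Since [E *m E^t* = 1], composing with the projector [E^t* *m E] does not change the compressed
   matrix. *)
have compE (Z : {vspace H}) m (E : 'M[R[i]]_(m, N)) (f : 'End(H)) D s :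
    E \is unitarymx ->
    (forall u, phi (orthoproj dot Z u) = phi u *m (E^t* *m E)) ->
    (forall (f : 'End(H)) (B : 'M[R[i]]_N), (forall u, u \in Z -> f u \in Z) ->
        (forall u, phi (f u) = phi u *m B) -> forall s,
        spectrum_of (E *m B *m E^t*) s -> Lambda (restr_op Z f) = s) ->
    (forall u, phi (f u) = phi u *m D) -> spectrum_of (E *m D *m E^t*) s ->
    Lambda (compression dot Z f) = s.
  move=> Eu Eproj Espec fD sD; apply: (Espec _ (D *m (E^t* *m E))).
  - by move=> u _; rewrite comp_lfunE orthoproj_mem.
  - by move=> u; rewrite comp_lfunE Eproj fD -!mulmxA.
  - by rewrite !mulmxA (mulmxtVK _ Eu).
(* The frame of the identity map of [H] is a square unitary matrix, which conjugates [B]. *)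
have LA : Lambda A = l.
  have [EH [EHu _ _ charH]] := @orthonormal_frame _ _ _ _ _ _ phi_lin phi_iso
    H (@idfun H) _ (fun x y e => e) erefl (leqnn N).
  have [_ sl _] := Bl; apply: LambdaE => //.
  rewrite (charH A B) ?(spectrum_of_char_poly (spectrum_of_conj Bl EHu)) // => u.
  by rewrite /= AB mulmxKtV.
have LX : Lambda (restr_op X A) = a.
  by apply: (EXspec A B) => // u uX; apply: (subvP inv_X); exact: memv_img.
have EXB : EX *m B = EX *m B *m EX^t* *m EX.
  apply/eqP; rewrite -subr_eq0 -2!mulmxA -mulmxBr; apply/eqP; apply: (EXspan N) => u uX.
  have AuX : A u \in X by apply: (subvP inv_X); exact: memv_img.
  by rewrite mulmxBr !mulmxA -AB EXid // subrr.
have EXS : EX *m ES^t* *m ES = EX.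
  apply/eqP; rewrite -subr_eq0 -mulmxA -[X in _ - X]mulmx1 -mulmxBr; apply/eqP.
  apply: (EXspan N) => u uX; rewrite mulmxBr mulmx1 mulmxA ESid ?subrr //.
  exact: subvP (addvSl X Y) _ uX.
have EYS : EY *m ES^t* *m ES = EY.
  apply/eqP; rewrite -subr_eq0 -mulmxA -[X in _ - X]mulmx1 -mulmxBr; apply/eqP.
  apply: (EYspan N) => u uY; rewrite mulmxBr mulmx1 mulmxA ESid ?subrr //.
  exact: subvP (addvSr X Y) _ uY.
have al : a = take n l by rewrite -LX top_X LA.
have [nm takeL lam_le maj] := matrix_majorization EXu EYu ESu EXS EYS EXB Bl Xa al SL Ylam Xc.
have c01 := cos2_bounds EXu EYu Xc.
rewrite (compE X _ EX A B a) // (compE Y _ EY A B lam) // (compE _ _ ES A B L) //.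
(* The operator defining [Theta] is the compression to [X] of the projector onto [Y]. *)
rewrite -/(compression dot X (orthoproj dot Y)).
rewrite (compE X _ EX (orthoproj dot Y) (EY^t* *m EY) c) // takeL.
have an := spectrum_of_size Xa; have lamn := spectrum_of_size Ylam.
have cn := spectrum_of_size Xc; have Lm := spectrum_of_size SL.
have rc01 i : 0 <= (rev c)`_i <= 1.
  have [ic|ci] := ltnP i (size c); first by rewrite nth_rev.
  by rewrite nth_default ?size_rev // lexx ler01.
rewrite (sin2_acos_sqrt rc01).
have sn : size [seq 1 - x | x <- rev c] = n by rewrite size_map size_rev.
have sE i : (i < n)%N -> [seq 1 - x | x <- rev c]`_i = 1 - (rev c)`_i.
  by move=> lin; rewrite (nth_map 0) // size_rev cn.
have diffE i : (vsub a lam)`_i = a`_i - lam`_i by rewrite nth_vsub // an lamn.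
have diffn : size (vsub a lam) = n by exact: size_vsub.
have diff_ge0 d : d \in vsub a lam -> 0 <= d.
  by case/(nthP 0) => i; rewrite diffn => lin <-; rewrite diffE subr_ge0 lam_le.
have ltKn (K : {set 'I_n}) (i : 'I_#|K|) : (i < n)%N.
  by rewrite (leq_trans (ltn_ord i)) // -[X in (_ <= X)%N]card_ord max_card.
have sprn : size (take n (rev L)) = n by rewrite size_takel // size_rev Lm.
have first_bound : weak_maj (vsub a lam)
    (vmul (vsub a (take n (rev L))) [seq 1 - x | x <- rev c]).
  apply: (@weak_maj_subset_sums _ _ _ n) => [//||K].
    by apply: size_vmul => //; exact: size_vsub.
  rewrite (eq_bigr (fun i : 'I_n => a`_i - lam`_i)) => [|i _]; last exact: diffE.
  apply: (le_trans (maj K)); rewrite le_eqVlt; apply/orP; left; apply/eqP.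
  apply: eq_bigr => i _; have lin := ltKn K i.
  rewrite nth_vmul ?nth_vsub ?sE ?nth_take // ?an ?sprn //.
  by rewrite sn; exact: size_vsub.
split.
  (* The absolute values disappear because all differences are nonnegative. *)
  have -> : [seq `|d| | d <- vsub a lam] = vsub a lam.
    by apply: map_id_in => d /diff_ge0; exact: ger0_norm.
  exact: first_bound.
split=> //.
apply: (@weak_maj_subset_sums _ _ _ n) => [//||K].
  by apply: size_vmul => //; rewrite size_map.
rewrite (eq_bigr (fun i : 'I_n => a`_i - lam`_i)) => [|i _]; last exact: diffE.
apply: (le_trans (maj K)); apply: ler_sum => i _; have lin := ltKn K i.
rewrite nth_vmul ?size_map ?size_rev ?an ?cn // sE // (nth_map 0) ?an //.
(* The squared sine is nonnegative, so each entry of [rev L] may be replaced by the smallest one,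
   the last of [L]. *)
have /andP[_ rc1] := rc01 i.
apply: ler_wpM2r; first by rewrite subr_ge0.
rewrite lerD2l lerN2 -nth_last nth_rev ?Lm ?(leq_trans lin) //.
have [_ sL _] := SL.
apply: nth_decreasing => //; rewrite ?Lm.
  by rewrite -subn1 leq_sub2l.
by rewrite ltn_predL (leq_trans _ nm) // (leq_ltn_trans _ lin).
Qed.
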